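(* Let $\mathbf{\Pi}=(\Pi(\Theta),\Pi(\Phi))$ be a standard partition, with $\Pi(\Theta)=\{\Theta_1,\dots,\Theta_{N_\Theta}\}$ and $\Pi(\Phi)=\{\Phi_{j,i}:1\le j\le N_\Theta,\ 1\le i\le N_r\}$, and let $\tilde Y_f=\{\tilde Y_{f,\theta}\}_{\theta\in\Pi(\Theta)}$ and $\tilde Y_H=\{\tilde Y_{H,\phi}\}_{\phi\in\Pi(\Phi)}$ be the $m$-summaries of two unknown Bernoulli fields in $\Pi(\Theta)$ and $\Pi(\Phi)$, respectively. Then for any Bernoulli fields $B_f\sim\tilde Y_f$ and $B_H\sim\tilde Y_H$ (i.e., whose $m$-summaries are $\tilde Y_f$ and $\tilde Y_H$, respectively), it holds that $L(H)\le\overline{L}_{\mathbf{\Pi}}(H)$, where $$\overline{L}_{\mathbf{\Pi}}(H)\triangleq\frac{\lambda Z_{B_H}}{|J(T)|}+\sum_{j=1}^{N_\Theta}\overline{\mathcal{L}}_{\Theta_j}(H),\qquad \overline{\mathcal{L}}_{\Theta_j}(H)\triangleq\max_{0\le\mathsf{q}_j\le|\Theta_j|}\Big[F_{\tilde Y_f,\Theta_j}(\mathsf{q}_j)+\Gamma_j(\mathsf{q}_j)\Big],$$ and $\Gamma_j(\mathsf{q}_j)$ is the solution to the problem $$\Gamma_j(\mathsf{q}_j)\triangleq\sup_{\mathsf{V}^0_j,\mathsf{V}^1_j}\gamma_j(\mathsf{q}_j,\mathsf{V}^0_j,\mathsf{V}^1_j)\quad\text{subject to}\quad 0\le\mathsf{v}^1_{j,i}\le|\Phi^1_{j,i}|,\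 \ 0\le\mathsf{v}^0_{j,i}\le|\Phi^0_{j,i}|\ \ (i=1,\dots,N_r),$$ with $\mathsf{V}^k_j=[\mathsf{v}^k_{j,1},\dots,\mathsf{v}^k_{j,N_r}]$ for $k\in\{0,1\}$ and $$\gamma_j(\mathsf{q}_j,\mathsf{V}^0_j,\mathsf{V}^1_j)\triangleq(|\Theta_j|-\mathsf{q}_j)\,\alpha\,\ell^0_j(\mathsf{q}_j,\mathsf{V}^0_j)+\mathsf{q}_j\log\Big(1-e^{\alpha\ell^1_j(\mathsf{q}_j,\mathsf{V}^1_j)}\Big)+\frac{\lambda}{|J(T)|}\sum_{i=1}^{N_r}F_{\tilde Y_H,\Phi_{j,i}}(\mathsf{v}^0_{j,i}+\mathsf{v}^1_{j,i}).$$
   Context: Setting. $\vec{c}\in\mathbb{R}^3$ is the camera center, $\Theta\subset S^2$ (a subset of the unit sphere, with solid-angle measure $d\vec{x}$) is the image domain, and $\Phi=\{\vec{c}+r\vec{x}:\vec{x}\in\Theta,\ R_{min}\le r\le R_{max}\}\subset\mathbb{R}^3$. Points of $\Phi$ are written $(\vec{x},r)$, so $\Phi=\Theta\times[R_{min},R_{max}]$ and volume is $r^2\,dr\,d\vec{x}$. $|\cdot|$ of a set denotes its measure. A partition of a set is a collection of pairwise disjoint sets whose union is the set. Continuous shapes. A continuous shape in $\Omega$ is an open set $s\subset\Omega$ whose boundary has measure zero, also regarded as its indicator function $s:\Omega\to\{0,1\}$. Bernoulli fields and $m$-summaries. A (continuous) Bernoulli field $B$ on $\Omega$ is a family of independent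 Bernoulli random variables $B(\vec{x})$, $\vec{x}\in\Omega$, given by success rates $p_B(\vec{x})=P(B(\vec{x})=1)$; its logit function is $\delta_B=\log\frac{p_B}{1-p_B}$ and its constant term is $Z_B=\int_\Omega\log(1-p_B(\vec{x}))\,d\vec{x}$. With $\delta_{max}>0$ a fixed constant and $m$ a positive integer, the $m$-summary of $B$ in a partition $\Pi(\Omega)$ assigns to each $\omega\in\Pi(\Omega)$ the vector $\tilde Y_{B,\omega}=[\tilde Y^{-m}_{B,\omega},\dots,\tilde Y^m_{B,\omega}]$ with $$\tilde Y^k_{B,\omega}=\Big|\Big\{\vec{x}\in\omega:\delta_B(\vec{x})<\frac{k\,\delta_{max}}{m}\Big\}\Big|,\qquad k=-m,\dots,m.$$ $B\sim\tilde Y$ means that these equalities hold for each $\omega\in\Pi(\Omega)$. Given an $m$-summary $\tilde Y$, a partition element $\omega$ and $S\in[0,|\omega|]$, let $J_\omega(S)=\min\{k:\tilde Y^k_\omega\ge|\omega|-S\}$ and $$F_{\tilde Y,\omega}(S)=\frac{\delta_{max}}{m}\Bigg[\sum_{k=J_\omega(S)}^{m-1}\big(\tilde Y^{k+1}_\omega-\tilde Y^k_\omega\big)(k+1)+J_\omega(S)\big(\tilde Y^{J_\omega(S)}_\omega-|\omega|+S\big)\Bigg].$$ Standard partition. $\Pi(\Theta)=\{\Theta_1,\dots,\Theta_{N_\Theta}\}$ is a partition of $\Theta$; $R_{min}=r_0<r_1<\dots<r_{N_r}=R_{max}$ with $r_i=\beta r_{i-1}=\beta^i r_0$ for some $\beta>1$;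 $\Pi(\Phi)$ consists of the sets $\Phi_{j,i}=\Theta_j\times[r_{i-1},r_i)$. Projection term and evidence. $\ell_v(\vec{x})=\int_0^{\infty}\frac{v(\vec{c}+r\vec{x})}{r}\,dr$. For a fixed $\alpha<0$, $\log P(\mathsf{q}|\ell)=\alpha\ell$ if $\mathsf{q}=0$ and $\log P(\mathsf{q}|\ell)=\log(1-e^{\alpha\ell})$ if $\mathsf{q}=1$. $H=(K,T)$ is a hypothesis (object class $K$ and pose $T$), where $T:\mathbb{R}^3\to\mathbb{R}^3$ is a transformation with Jacobian $|J(T)|$, and $\lambda>0$ is a constant. For Bernoulli fields $B_f$ on $\Theta$ (from the input image) and $B_H$ on $\Phi$ (from the hypothesis), the evidence is $$L(H)=\sup_{q,v}\Big\{\int_\Theta\Big[q(\vec{x})\delta_{B_f}(\vec{x})+\log P(q(\vec{x})|\ell_v(\vec{x}))+\frac{\lambda}{|J(T)|}\int_{R_{min}}^{R_{max}}r^2v(\vec{x},r)\delta_{B_H}(\vec{x},r)\,dr\Big]d\vec{x}+\frac{\lambda Z_{B_H}}{|J(T)|}\Big\},$$ the supremum being over continuous shapes $q$ in $\Theta$ and $v$ in $\Phi$. Auxiliary quantities. Let $\Upsilon(a,\rho_0,\rho_1)=\frac a3(\rho_1^3-\rho_0^3)$. Here $\Phi^1_{j,i}=\Theta^1_j\times[r_{i-1},r_i]$ and $\Phi^0_{j,i}=\Theta^0_j\times[r_{i-1},r_i]$, where $\Theta^1_j$ and $\Theta^0_j$ are the parts of $\Theta_j$ where a segmentation of mass $\mathsf{q}_j$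 in $\Theta_j$ equals $1$ and $0$, respectively; only the volumes matter: $|\Phi^1_{j,i}|=\Upsilon(\mathsf{q}_j,r_{i-1},r_i)$ and $|\Phi^0_{j,i}|=\Upsilon(|\Theta_j|-\mathsf{q}_j,r_{i-1},r_i)$. The radii $\rho^1_{j,i}=\rho^1_{j,i}(\mathsf{q}_j,\mathsf{v}^1_{j,i})$ and $\rho^0_{j,i}=\rho^0_{j,i}(\mathsf{q}_j,\mathsf{v}^0_{j,i})$ are the solutions of $\mathsf{v}^1_{j,i}=\Upsilon(\mathsf{q}_j,r_{i-1},\rho^1_{j,i})$ and $\mathsf{v}^0_{j,i}=\Upsilon(|\Theta_j|-\mathsf{q}_j,\rho^0_{j,i},r_i)$, and $$\ell^0_j(\mathsf{q}_j,\mathsf{V}^0_j)=\sum_{i=1}^{N_r}\log\frac{r_i}{\rho^0_{j,i}},\qquad \ell^1_j(\mathsf{q}_j,\mathsf{V}^1_j)=\sum_{i=1}^{N_r}\log\frac{\rho^1_{j,i}}{r_{i-1}}.$$ (When $\mathsf{q}_j=0$ or $\mathsf{q}_j=|\Theta_j|$ the radius that is not determined enters only through a term of $\gamma_j$ with coefficient $0$, which is read as $0$.) *)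

(* Defs.v *)
From HB Require Import structures.
From mathcomp Require Import all_boot all_order all_algebra.
From mathcomp Require Import all_classical all_reals all_analysis.
From mathcomp Require Import measurable_realfun.

Set Implicit Arguments.
Unset Strict Implicit.
Unset Printing Implicit Defensive.

Import Order.TTheory GRing.Theory Num.Theory.
Import numFieldNormedType.Exports.

Local Open Scope classical_set_scope.
Local Open Scope ring_scope.

Definition R3 (R : realType) : Type := (R * R * R)%type.

Definition norm3 {R : realType} (x : R3 R) : R :=
  Num.sqrt (x.1.1 ^+ 2 + x.1.2 ^+ 2 + x.2 ^+ 2).

Definition sphere {R : realType} : set (R3 R) := [set x | norm3 x = 1].

Definition direction {R : realType} (x : R3 R) : R3 R := (norm3 x)^-1 *: x.

Definition volume {R : realType} : set (R3 R) -> \bar R :=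
  ((@lebesgue_measure R \x @lebesgue_measure R) \x @lebesgue_measure R)%E.

(* Surface measure of the unit sphere: three times the volume of the cone
   {r x : x \in A, 0 < r <= 1} over A.  It is a measure on R^3 that only sees
   the part of A lying on the sphere. *)
Definition solid_angle {R : realType} (A : set (R3 R)) : \bar R :=
  (3%:E * volume ([set y | 0 < norm3 y <= 1]%R `&` direction @^-1` A))%E.

Section measures.
Variable R : realType.

Let lebesgue3 : {measure set (measurableTypeR R * measurableTypeR R
                              * measurableTypeR R)%type -> \bar R} :=
  ((@lebesgue_measure R \x @lebesgue_measure R) \x @lebesgue_measure R)%E.

Let volume0 : @volume R set0 = 0%E.
Proof. exact: (measure0 lebesgue3). Qed.

Let volume_ge0 A : (0 <= @volume R A)%E.
Proof. exact: (measure_ge0 lebesgue3 A). Qed.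

Let volume_sigma_additive : semi_sigma_additive (@volume R).
Proof. exact: (@measure_semi_sigma_additive _ _ _ lebesgue3). Qed.

HB.instance Definition _ := isMeasure.Build _ _ _ (@volume R)
  volume0 volume_ge0 volume_sigma_additive.

Lemma measurable_norm3 : measurable_fun setT (@norm3 R).
Proof.
apply: (@measurableT_comp _ _ _ _ _ _ (@Num.sqrt R)).
  by apply: continuous_measurable_fun; exact: sqrt_continuous.
apply: measurable_funD; first apply: measurable_funD; apply: measurable_funX.
- exact: (measurableT_comp measurable_fst measurable_fst).
- exact: (measurableT_comp measurable_snd measurable_fst).
- exact: measurable_snd.
Qed.

Lemma measurable_direction : measurable_fun setT (@direction R).
Proof.
have mV : measurable_fun setT (fun x : R3 R => (norm3 x)^-1).
  rewrite (_ : (fun _ => _) = (fun x => norm3 x `^ (-1))).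
    apply: (@measurableT_comp _ _ _ _ _ _ (fun a : R => a `^ (-1))).
      exact: measurable_powR.
    exact: measurable_norm3.
  by apply/funext => x; rewrite powR_inv1// sqrtr_ge0.
apply: measurable_fun_pair; first apply: measurable_fun_pair;
  apply: (measurable_funM mV).
- exact: (measurableT_comp measurable_fst measurable_fst).
- exact: (measurableT_comp measurable_snd measurable_fst).
- exact: measurable_snd.
Qed.

Lemma measurable_punctured_ball :
  measurable [set y : R3 R | 0 < norm3 y <= 1].
Proof.
rewrite (_ : [set _ | _] = @norm3 R @^-1` `]0, 1]); last first.
  by apply/seteqP; split => x /=; rewrite in_itv.
by rewrite -[X in measurable X]setTI; exact: measurable_norm3.
Qed.

Let cone_measure : {measure set (R3 R) -> \bar R} :=
  mscale (3%:nng : {nonneg R})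
    (measure_function_pushforward__canonical__measure_function_Measure
       (mrestr (@volume R) measurable_punctured_ball) measurable_direction).

Let solid_angleE : @solid_angle R = cone_measure.
Proof.
apply/funext => A; rewrite /solid_angle /cone_measure /= /mscale/=.
by rewrite /pushforward /mrestr setIC.
Qed.

Let solid_angle0 : @solid_angle R set0 = 0%E.
Proof. by rewrite solid_angleE; exact: measure0. Qed.

Let solid_angle_ge0 A : (0 <= @solid_angle R A)%E.
Proof. by rewrite solid_angleE; exact: measure_ge0. Qed.

Let solid_angle_sigma_additive : semi_sigma_additive (@solid_angle R).
Proof. by rewrite solid_angleE; exact: measure_semi_sigma_additive. Qed.

HB.instance Definition _ := isMeasure.Build _ _ _ (@solid_angle R)
  solid_angle0 solid_angle_ge0 solid_angle_sigma_additive.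

End measures.

(* A continuous shape in Om, for Om inside the ambient space X (the unit sphere
   or the whole of R^3): a subset of Om that is open in X and whose boundary in
   X has measure zero.  As s is open in X, this boundary is the closure of s in
   X minus s. *)
Definition continuous_shape {R : realType} (mu : set (R3 R) -> \bar R)
    (X Om s : set (R3 R)) : Prop :=
  [/\ s `<=` Om, exists2 U, open U & s = X `&` U
    & mu ((X `&` closure s) `\` s) = 0%E].

Section bernoulli_fields.
Context {R : realType} {d : measure_display} {T : measurableType d}.

Section random_field.
Context {d' : measure_display} {S : measurableType d'} (P : probability S R).

Definition success_rate (B : T -> S -> bool) (x : T) : R :=
  fine (P [set w | B x w]).

(* Independence is the product rule on every finite subfamily.  Measurability of
   the success rate is what gives a meaning to the constant term and to the
   summaries.  The values of B outside Om are irrelevant. *)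
Definition bernoulli_field (Om : set T) (B : T -> S -> bool) : Prop :=
  [/\ forall x, Om x -> measurable_fun setT (B x),
      forall (s : seq T) (E : T -> set bool), uniq s -> [set` s] `<=` Om ->
        fine (P (\bigcap_(x in [set` s]) (B x @^-1` E x))) =
        \prod_(x <- s) fine (P (B x @^-1` E x))
    & measurable_fun Om (success_rate B)].

End random_field.

(* Extended-real valued: -oo where p x = 0 and +oo where p x = 1. *)
Definition logit (p : T -> R) (x : T) : \bar R :=
  lne ((p x)%:E / (1 - p x)%:E)%E.

Definition constant_term (mu : set T -> \bar R) (Om : set T) (p : T -> R) :
  \bar R := (\int[mu]_(x in Om) lne (1 - p x)%:E)%E.

(* A summary is indexed by the signed k = -m, ..., m; its values at other
   integers are irrelevant. *)
Definition is_summary (mu : set T -> \bar R) (dmax : R) (m : nat) (I : Type)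
    (Pi : I -> set T) (p : T -> R) (Y : I -> int -> R) : Prop :=
  forall w (k : int), - m%:Z <= k <= m%:Z ->
    mu (Pi w `&` [set x | (logit p x < (k%:~R * dmax / m%:R)%:E)%E]) =
    (Y w k)%:E.

End bernoulli_fields.

Section summary_bound.
Context {R : realType} (dmax : R) (m : nat).
Implicit Types (Y : int -> R) (w S : R).

(* J_w(S) is a minimum over a nonempty set for every S in [0, |w|]. *)
Definition J_defined Y w : Prop :=
  forall S, 0 <= S <= w -> exists2 k : int, - m%:Z <= k <= m%:Z & w - S <= Y k.

(* The indices k = -m, ..., m are enumerated as k = t - m with 0 <= t <= 2m. *)
Definition J Y w S : int :=
  [arg min_(t < (ord_max : 'I_(m.*2.+1)) | w - S <= Y (t%:Z - m%:Z)) t]%:Z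
  - m%:Z.

Definition F Y w S : R :=
  dmax / m%:R *
  (\sum_(t < m.*2 | J Y w S <= t%:Z - m%:Z)
      (Y (t%:Z - m%:Z + 1) - Y (t%:Z - m%:Z)) * (t%:Z - m%:Z + 1)%:~R
   + (J Y w S)%:~R * (Y (J Y w S) - w + S)).

End summary_bound.

Section partitions.
Context {R : realType}.

Definition ray (c x : R3 R) (r : R) : R3 R := c + r *: x.

Definition shell (c : R3 R) (A : set (R3 R)) (I : set R) : set (R3 R) :=
  [set ray c x r | x in A & r in I].

(* Rmin > 0 follows from r 0 < r 1 = beta * r 0 and 1 < beta. *)
Record standard_partition (Theta : set (R3 R)) (Rmin Rmax beta : R)
    (NT Nr : nat) (Thetas : 'I_NT -> set (R3 R)) (r : nat -> R) : Prop :=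
  StandardPartition {
    part_measurable : forall j, measurable (Thetas j);
    part_disjoint : trivIset setT Thetas;
    part_cover : \bigcup_j Thetas j = Theta;
    part_beta : 1 < beta;
    part_Nr : (0 < Nr)%N;
    part_rmin : r 0%N = Rmin;
    part_rmax : r Nr = Rmax;
    part_incr : forall i, (i < Nr)%N -> r i < r i.+1;
    part_geom : forall i, (i < Nr)%N -> r i.+1 = beta * r i }.

(* Radial cells are numbered from 0: i stands for the cell [r_i, r_{i+1}). *)
Definition cells (c : R3 R) (NT Nr : nat) (Thetas : 'I_NT -> set (R3 R))
    (r : nat -> R) (ji : 'I_NT * 'I_Nr) : set (R3 R) :=
  shell c (Thetas ji.1) `[r ji.2, r ji.2.+1[.

End partitions.

(* A hypothesis pairs an object class, taken in a type K, with a pose. *)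
Definition hypothesis (R : realType) (K : Type) : Type :=
  (K * (R3 R -> R3 R))%type.

Section hypotheses.
Context {R : realType}.

Definition pose_of K (H : hypothesis R K) : R3 R -> R3 R := H.2.

Definition to_row (x : R3 R) : 'rV[R]_3 := \row_(i < 3) [:: x.1.1; x.1.2; x.2]`_i.
Definition of_row (u : 'rV[R]_3) : R3 R := (u 0 0, u 0 1, u 0 2).

Definition abs_jacobian (T : R3 R -> R3 R) (y : R3 R) : R :=
  `| \det ('J (to_row \o T \o of_row) (to_row y)) |.

(* T is a differentiable map whose Jacobian has the constant nonzero absolute
   value JT. *)
Definition has_abs_jacobian (T : R3 R -> R3 R) (JT : R) : Prop :=
  0 < JT /\ forall y, differentiable T y /\ abs_jacobian T y = JT.

End hypotheses.

Section evidence.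
Context {R : realType}.

(* At r = 0 the integrand is 0 by the convention 0^-1 = 0. *)
Definition projection (c : R3 R) (v : set (R3 R)) (x : R3 R) : \bar R :=
  (\int[lebesgue_measure]_(r in `[0%R, +oo[) (\1_v (ray c x r) / r)%:E)%E.

Definition log_P (alpha : R) (q : bool) (l : \bar R) : \bar R :=
  if q then lne (1 - expeR (alpha%:E * l))%E else (alpha%:E * l)%E.

Context (c : R3 R) (Theta : set (R3 R)) (Rmin Rmax alpha lambda JT : R).
Context (pf pH : R3 R -> R).

Definition evidence_at (q v : set (R3 R)) : \bar R :=
  (\int[solid_angle]_(x in Theta)
     ((\1_q x)%:E * logit pf x + log_P alpha (x \in q) (projection c v x)
      + (lambda / JT)%:E *
        \int[lebesgue_measure]_(r in `[Rmin, Rmax])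
          ((r ^+ 2 * \1_v (ray c x r))%:E * logit pH (ray c x r)))
   + (lambda / JT)%:E
     * constant_term volume (shell c Theta `[Rmin, Rmax]) pH)%E.

Definition evidence : \bar R :=
  ereal_sup [set z | exists q v : set (R3 R),
    [/\ continuous_shape solid_angle sphere Theta q,
        continuous_shape volume setT (shell c Theta `[Rmin, Rmax]) v
      & z = evidence_at q v]].

End evidence.

Section upper_bound.
Context {R : realType}.

Definition Upsilon (a rho0 rho1 : R) : R := a / 3 * (rho1 ^+ 3 - rho0 ^+ 3).

(* The solution is unique if a != 0.  If a = 0 the value is arbitrary and only
   enters gamma multiplied by 0. *)
Definition outer_radius (a r0 v : R) : R :=
  xget r0 [set rho | v = Upsilon a r0 rho].
Definition inner_radius (a r1 v : R) : R :=
  xget r1 [set rho | v = Upsilon a rho r1].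

Context (c : R3 R) (NT Nr : nat) (Thetas : 'I_NT -> set (R3 R)) (r : nat -> R).
Context (dmax : R) (m : nat) (alpha lambda JT : R).
Context (Yf : 'I_NT -> int -> R) (YH : 'I_NT * 'I_Nr -> int -> R).
Context (j : 'I_NT).

Local Notation area := (fine (solid_angle (Thetas j))).

Definition ell0 (q : R) (V0 : 'I_Nr -> R) : R :=
  \sum_(i < Nr) ln (r i.+1 / inner_radius (area - q) (r i.+1) (V0 i)).

Definition ell1 (q : R) (V1 : 'I_Nr -> R) : R :=
  \sum_(i < Nr) ln (outer_radius q (r i) (V1 i) / r i).

(* lne 0 = -oo, and 0 * -oo = 0 in \bar R. *)
Definition gamma (q : R) (V0 V1 : 'I_Nr -> R) : \bar R :=
  (((area - q) * (alpha * ell0 q V0))%:E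
   + q%:E * lne (1 - expR (alpha * ell1 q V1))%:E
   + (lambda / JT * \sum_(i < Nr)
        F dmax m (YH (j, i)) (fine (volume (cells c Thetas r (j, i))))
          (V0 i + V1 i))%:E)%E.

Definition Gamma (q : R) : \bar R :=
  ereal_sup [set z | exists V0 V1 : 'I_Nr -> R,
    [/\ forall i, 0 <= V1 i <= Upsilon q (r i) (r i.+1),
        forall i, 0 <= V0 i <= Upsilon (area - q) (r i) (r i.+1)
      & z = gamma q V0 V1]].

Definition objective (q : R) : \bar R :=
  ((F dmax m (Yf j) area q)%:E + Gamma q)%E.

(* The maximum over [0, |Theta_j|], as a supremum; that it is attained is part
   of the theorem. *)
Definition local_bound : \bar R :=
  ereal_sup [set objective q | q in `[0, area]].

End upper_bound.

Definition evidence_bound {R : realType} (c : R3 R) (Theta : set (R3 R))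
    (Rmin Rmax : R) (NT Nr : nat) (Thetas : 'I_NT -> set (R3 R))
    (r : nat -> R) (dmax : R) (m : nat) (alpha lambda JT : R)
    (Yf : 'I_NT -> int -> R) (YH : 'I_NT * 'I_Nr -> int -> R)
    (pH : R3 R -> R) : \bar R :=
  ((lambda / JT)%:E
     * constant_term volume (shell c Theta `[Rmin, Rmax]) pH
   + \sum_(j < NT)
       local_bound c Thetas r dmax m alpha lambda JT Yf YH j)%E.

(* Main.v *)
(* L is bounded one solid angle Theta_j at a time, by linear programming duality.
   Fix shapes q and v.  Given the areas and volumes they occupy, the terms in the
   logits are linear functionals of indicator functions and F is the value of
   the resulting knapsack problem: the lower envelope of the affine functions
   threshold u * S + excess u, one for each multiplier threshold u.  The integrals
   of 1/r along the rays compare, after an exchange argument with multiplier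
   rho^-3, with those of a full layer of cell i that ends or starts at radius rho
   and has the same volume.  The concave term log (1 - e^(alpha l)) lies below its
   tangents, written ln y <= ln t + y / t - 1 so as to cover y = 0.  Hence the
   integrand is below an explicit function, for each choice of the multipliers,
   and polar coordinates identify the integral of that function over Theta_j.
   The infimum over the multipliers is F + gamma at q_j and at the
   volumes occupied by v.

   With the radii as variables instead of the volumes, each of these upper bounds
   is continuous on a compact box, so the quantity to be maximized, being their
   pointwise infimum, is upper semicontinuous: the maximum over q_j is attained. *)

From HB Require Import structures.
Require Import Defs.
From mathcomp Require Import all_boot all_order all_algebra.
From mathcomp Require Import all_classical all_reals all_analysis.
From mathcomp Require Import measurable_realfun ring lra zify.
Import Order.TTheory GRing.Theory Num.Theory.
Import numFieldNormedType.Exports.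
Local Open Scope classical_set_scope.
Local Open Scope ring_scope.
Set Implicit Arguments.
Unset Strict Implicit.
Unset Printing Implicit Defensive.

(** * Affine changes of variables *)

(** The comparisons behind the bound hold between averages over [Theta_j], while on a single ray the
    mass of [v] and the projection deviate from these averages. Each concave or extremal step is
    therefore used in linearized form, with parameters common to all rays: [bathtub_le] and
    [bathtub_ge] with a fixed [rho], and tangents to [ln] and [exp] at fixed points. What is left on
    a ray is a multiple of [slack], whose integral is 0 once the radii match the volumes of [v].
    Logits are extended reals. From above they are controlled by [J_defined] at [S = 0], which
    forces the top summary value to be the full measure, so that the logit is below [dmax] almost
    everywhere. From below they may be [-oo], so the evidence integrand is only compared with
    integrable upper bounds. The maximum over [q] is not read off in the volumes, because their
    constraints move with [q] and the radii have no limit as [q] tends to 0 or to the full area. The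
    box of radii is fixed, and volumes depend continuously on [q] and the radii. *)

Definition plane_area (R : realType) :
    set (measurableTypeR R * measurableTypeR R)%type -> \bar R :=
  (@lebesgue_measure R \x @lebesgue_measure R)%E.
HB.instance Definition _ (R : realType) := Measure.on (@plane_area R).

Lemma plane_area_square (R : realType) (a : R) : 0 <= a ->
  let I := `[(- a)%R, a]%classic : set (measurableTypeR R) in
  plane_area (I `*` I) = ((a *+ 2) ^+ 2)%:E.
Proof.
move=> a0 I; have mI : measurable I by exact: measurable_itv.
have IE : lebesgue_measure I = (a *+ 2)%:E.
  rewrite /I lebesgue_measure_itv/= lte_fin -EFinB.
  case: ltP => aa; first by congr EFin; rewrite mulr2n; ring.
  by congr EFin; rewrite mulr2n; lra.
have E : plane_area (I `*` I) = (lebesgue_measure I * lebesgue_measure I)%E.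
  exact: (product_measure1E lebesgue_measure lebesgue_measure mI mI).
by rewrite E IE -EFinM expr2.
Qed.

(** Uniqueness of product measures asks for sigma-finite factors; with this instance [volume] is the
    product of [plane_area] and the measure of the line. *)
Lemma plane_area_sigma_finite (R : realType) : sigma_finite setT (@plane_area R).
Proof.
pose I (n : nat) : set (measurableTypeR R) := `[(- n%:R)%R, n%:R]%classic.
exists (fun n => I n `*` I n).
  apply/esym/seteqP; split => // -[x y] _.
  exists (Num.truncn (`|x| + `|y|)).+1 => //.
  have := truncnS_gt (`|x| + `|y|); set n := _.+1 => xyn.
  by split; rewrite /I/= in_itv/= -ler_norml; have := normr_ge0 x; have := normr_ge0 y; lra.
move=> n; split; first by apply: measurableX; exact: measurable_itv.
by rewrite plane_area_square// ltry.
Qed.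

HB.instance Definition _ (R : realType) :=
  Measure_isSigmaFinite.Build _ _ _ (@plane_area R) (@plane_area_sigma_finite R).

Section product_scaling.
Context {d1 d2} {T1 : measurableType d1} {T2 : measurableType d2} {R : realType}.
Variable m1 : {sigma_finite_measure set T1 -> \bar R}.
Variable m2 : {sigma_finite_measure set T2 -> \bar R}.
(** The pushforward divided by [c1 * c2] agrees with the product measure on rectangles, hence
    everywhere. *)
Lemma product_measure_scale (f1 : T1 -> T1) (f2 : T2 -> T2) (c1 c2 : R) :
  measurable_fun setT f1 -> measurable_fun setT f2 -> 0 < c1 -> 0 < c2 ->
  (forall A, measurable A -> m1 (f1 @^-1` A) = c1%:E * m1 A)%E ->
  (forall A, measurable A -> m2 (f2 @^-1` A) = c2%:E * m2 A)%E ->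
  forall X, measurable X ->
   ((m1 \x m2) ((fun z => (f1 z.1, f2 z.2)) @^-1` X) = (c1 * c2)%:E * (m1 \x m2) X)%E.
Proof.
move=> mf1 mf2 c10 c20 H1 H2 X mX.
have mf : measurable_fun setT (fun z : T1 * T2 => (f1 z.1, f2 z.2)).
  by apply: measurable_fun_pair; apply: measurableT_comp.
have c0 : 0 <= (c1 * c2)^-1 by rewrite invr_ge0 mulr_ge0// ltW.
pose m' : {measure set (T1 * T2) -> \bar R} :=
  mscale (NngNum c0) (measure_function_pushforward__canonical__measure_function_Measure
    (m1 \x m2)%E mf).
have E : (m1 \x m2)%E X = m' X.
  apply: product_measure_unique => // A B mA mB.
  rewrite /m' /= /mscale /= /pushforward.
  have -> : (fun z => (f1 z.1, f2 z.2)) @^-1` (A `*` B) = (f1 @^-1` A) `*` (f2 @^-1` B) by [].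
  rewrite product_measure1E; last 2 first.
  - by rewrite -[X in measurable X]setTI; exact: mf1.
  - by rewrite -[X in measurable X]setTI; exact: mf2.
  rewrite [X in (_ * (X * _))%E](H1 A mA) [X in (_ * (_ * X))%E](H2 B mB) (muleACA c1%:E) !muleA -!EFinM -(mulrA _ c1) mulVf ?mul1e//.
  by rewrite mulf_neq0// gt_eqF.
by rewrite E /m' /= /mscale /= /pushforward muleA -EFinM divff ?mul1e// mulf_neq0// gt_eqF.
Qed.
End product_scaling.

Lemma lebesgue_measure_affine {R : realType} (a t : R) : 0 < t ->
  forall A, measurable A ->
  (lebesgue_measure ((fun x : measurableTypeR R => t^-1 * (x - a))%R @^-1` A) = t%:E * lebesgue_measure A)%E.
Proof.
move=> t0 A mA.
have mf : measurable_fun setT (fun x : measurableTypeR R => t^-1 * (x - a) : measurableTypeR R).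
  by apply: measurable_funM => //; apply: measurable_funB.
have c0 : 0 <= t^-1 by rewrite invr_ge0 ltW.
pose m' : {measure set (measurableTypeR R) -> \bar R} :=
  mscale (NngNum c0) (measure_function_pushforward__canonical__measure_function_Measure
    lebesgue_measure mf).
have E : lebesgue_measure A = m' A.
  apply: lebesgue_measure_unique => // _ [[x y] /= _ <-].
  rewrite /m' /= /mscale /= /pushforward.
  have -> : (fun x : R => t^-1 * (x - a)) @^-1` `]x, y] = `]t * x + a, t * y + a]%classic.
    apply/seteqP; split => z /=; rewrite !in_itv/= ![t^-1 * _]mulrC ltr_pdivlMr// ler_pdivrMr// ltrBrDr lerBlDr [x * _]mulrC [y * _]mulrC//.
  rewrite !lebesgue_measure_itv/= !lte_fin ltrD2r ltr_pM2l//; case: ifPn => xy; last by rewrite mule0.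
  by rewrite -!EFinD -EFinM; congr EFin; field; lra.
by rewrite E /m' /= /mscale /= /pushforward muleA -EFinM divff ?mul1e ?gt_eqF.
Qed.

(** Used twice: with center 0 it scales cones, with [t = 1] it moves the camera center to the
    origin. *)
Lemma volume_affine {R : realType} (c : R3 R) (t : R) : 0 < t ->
  forall A : set (R3 R), measurable A ->
  (volume ((fun x => t^-1 *: (x - c))%R @^-1` A) = (t ^+ 3)%:E * volume A)%E.
Proof.
move=> t0 A mA.
have mf (a : R): measurable_fun setT (fun x : measurableTypeR R => t^-1 * (x - a) : measurableTypeR R).
  by apply: measurable_funM => //; apply: measurable_funB.
have -> : (t ^+ 3) = (t * t) * t by rewrite !exprS expr0; ring.
rewrite /volume -/(@plane_area R).
pose g (a b : R) (z : R * R) := (t^-1 * (z.1 - a), t^-1 * (z.2 - b)).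
have mg : measurable_fun setT (g c.1.1 c.1.2).
  apply: measurable_fun_pair; apply: measurable_funM => //; apply: measurable_funB => //.
rewrite -(@product_measure_scale _ _ _ _ _ (@plane_area R) (@lebesgue_measure R) (g c.1.1 c.1.2) _ _ _ mg (mf c.2))//.
- by rewrite mulr_gt0.
- by move=> B mB; exact: (@product_measure_scale _ _ _ _ _ lebesgue_measure lebesgue_measure
    _ _ _ _ (mf c.1.1) (mf c.1.2) t0 t0 (lebesgue_measure_affine _ t0) (lebesgue_measure_affine _ t0) _ mB).
- exact: lebesgue_measure_affine.
Qed.

(** * Polar coordinates *)

Section radial_integrals.
Context {R : realType}.
Notation mu := (@lebesgue_measure R).

(** The case [a = b] is kept because a layer ending or starting at [rho] may be empty. *)
Lemma integral_itv_antiderivative (f F : R -> R) (a b : R) (b0 b1 : bool) : a <= b ->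
  (forall x, a <= x <= b -> {for x, continuous f}) ->
  (forall x : R, a <= x <= b -> is_derive x 1 F (f x)) ->
  (\int[mu]_(x in [set` Interval (BSide b0 a) (BSide b1 b)]) (f x)%:E
   = (F b - F a)%:E)%E.
Proof.
move=> ab cf dF.
have mE : measurable_fun `]a, b[ (EFin \o f).
  apply/measurable_EFinP; apply: open_continuous_measurable_fun => // x.
  by rewrite inE/= in_itv/= => /andP[ax xb]; apply: cf; rewrite (ltW ax) (ltW xb).
rewrite (@integral_itv_bndoo _ a b (EFin \o f))// -(@integral_itv_bndoo _ a b (EFin \o f) true false)//.
move: ab; rewrite le_eqVlt => /predU1P[->|ab].
  by rewrite set_itv1 integral_set1 subrr.
have cF x : a <= x <= b -> {for x, continuous F}.
  by move=> /dF [dFx _]; apply: differentiable_continuous; exact/derivable1_diffP.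
rewrite (@continuous_FTC2 _ f F)//.
- apply: continuous_in_subspaceT => x; rewrite inE/= in_itv/=; exact: cf.
- split.
  + by move=> x; rewrite in_itv/= => /andP[ax xb]; have [] : is_derive x 1 F (f x) by apply: dF; rewrite (ltW ax) (ltW xb).
  + by apply: cvg_at_right_filter; apply: cF; rewrite lexx ltW.
  + by apply: cvg_at_left_filter; apply: cF; rewrite lexx ltW.
- move=> x; rewrite in_itv/= => /andP[ax xb].
  have [_] : is_derive x 1 F (f x) by apply: dF; rewrite (ltW ax) (ltW xb).
  by rewrite derive1E.
Qed.

Lemma integral_sqr (a b : R) (b0 b1 : bool) : a <= b ->
  (\int[mu]_(x in [set` Interval (BSide b0 a) (BSide b1 b)]) (x ^+ 2)%:E
   = ((b ^+ 3 - a ^+ 3) / 3)%:E)%E.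
Proof.
move=> ab; transitivity ((3^-1 * b ^+ 3 - 3^-1 * a ^+ 3)%:E); last by congr EFin; field.
apply: (@integral_itv_antiderivative (fun x => x ^+ 2) (fun x => 3^-1 * x ^+ 3)) => //.
- by move=> x _; exact: exprn_continuous.
- move=> x _; apply: is_derive_eq. by rewrite /GRing.scale/=; field.
Qed.

Lemma integral_inv (a b : R) (b0 b1 : bool) : 0 < a -> a <= b ->
  (\int[mu]_(x in [set` Interval (BSide b0 a) (BSide b1 b)]) (x^-1)%:E
   = (ln (b / a))%:E)%E.
Proof.
move=> a0 ab; rewrite ln_div ?posrE//; last exact: lt_le_trans ab.
apply: (@integral_itv_antiderivative GRing.inv (@ln R)) => //.
- move=> x /andP[ax _]; apply: inv_continuous; rewrite gt_eqF//; exact: lt_le_trans ax.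
- move=> x /andP[ax _]; apply: is_derive1_ln; exact: lt_le_trans ax.
Qed.

End radial_integrals.

Section radial_measure.
Context {R : realType}.
Notation mu := (@lebesgue_measure R).

(* The cut-off at b keeps the measure finite. *)
Definition radial_measure (b : R) (B : set (measurableTypeR R)) : \bar R :=
  (\int[mu]_(r in `]0%R, b] `&` B) (r ^+ 2)%:E)%E.

Variable b : R.

Let radial0 : radial_measure b set0 = 0%E.
Proof. by rewrite /radial_measure setI0 integral_set0. Qed.

Let radial_ge0 B : (0 <= radial_measure b B)%E.
Proof. by apply: integral_ge0 => r _; rewrite lee_fin sqr_ge0. Qed.

Let msqr (D : set (measurableTypeR R)) : measurable_fun D (fun r : R => (r ^+ 2)%:E).
Proof. by apply/measurable_EFinP; apply: measurable_funX; exact: measurable_id. Qed.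

Let radial_sigma_additive : semi_sigma_additive (radial_measure b).
Proof.
move=> /= F mF tF mUF; rewrite /radial_measure; apply: cvg_toP.
  apply: ereal_nondecreasing_is_cvgn => m n mn.
  by apply: lee_sum_nneg_natr => // k _ _; exact: radial_ge0.
rewrite setI_bigcupr ge0_integral_bigcup//=.
- by move=> i; apply: measurableI.
- by move=> x _; rewrite lee_fin sqr_ge0.
- exact: trivIset_setIl.
Qed.

HB.instance Definition _ := isMeasure.Build _ _ _ (radial_measure b)
  radial0 radial_ge0 radial_sigma_additive.

Lemma radial_measure_fin : fin_num_fun (radial_measure b).
Proof.
move=> B mB; rewrite ge0_fin_numE//.
apply: (@le_lt_trans _ _ (radial_measure b setT)); first by apply: le_measure; rewrite ?inE.
rewrite /radial_measure setIT.
have [b0|b0] := ltP 0 b; first by rewrite integral_sqr ?ltW// ltry.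
by rewrite set_itv_ge ?integral_set0// bnd_simp -leNgt.
Qed.

HB.instance Definition _ := Measure_isFinite.Build _ _ _ (radial_measure b)
  radial_measure_fin.

End radial_measure.

Section polar.
Context {R : realType}.
Implicit Types (c x : R3 R) (A E : set (R3 R)).

Definition cone (b : R) A : set (R3 R) := [set y | 0 < norm3 y <= b /\ A (direction y)].

Lemma norm3_ge0 x : 0 <= norm3 x. Proof. exact: sqrtr_ge0. Qed.

Lemma norm3Z (t : R) x : 0 <= t -> norm3 (t *: x) = t * norm3 x.
Proof.
move=> t0; rewrite /norm3 /= /GRing.scale/= /GRing.scale /=.
rewrite !exprMn -!mulrDr sqrtrM ?sqr_ge0// sqrtr_sqr ger0_norm//.
Qed.

Lemma directionK x : 0 < norm3 x -> norm3 x *: direction x = x.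
Proof. by move=> x0; rewrite /direction scalerA divff ?gt_eqF// scale1r. Qed.

Lemma direction_scale (t : R) x : 0 < t -> direction (t *: x) = direction x.
Proof.
move=> t0; rewrite /direction norm3Z ?ltW// scalerA; congr (_ *: _).
have [->|x0] := eqVneq (norm3 x) 0; first by rewrite mulr0 invr0 mul0r.
by rewrite invfM; field; rewrite x0 gt_eqF.
Qed.

Lemma measurable_cone b A : measurable A -> measurable (cone b A).
Proof.
move=> mA; have -> : cone b A = (@norm3 R @^-1` `]0, b]) `&` (direction @^-1` A).
  by apply/seteqP; split => y; rewrite /cone/= in_itv/=.
apply: measurableI.
- by rewrite -[X in measurable X]setTI; exact: measurable_norm3.
- by rewrite -[X in measurable X]setTI; exact: measurable_direction.
Qed.

Lemma solid_angle_cone A : (solid_angle A = 3%:E * volume (cone 1 A))%E.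
Proof.
by rewrite /solid_angle; congr (_ * volume _)%E; apply/seteqP; split => y.
Qed.

Lemma volume_cone1 A : measurable A -> (volume (cone 1 A) = (3^-1)%:E * solid_angle A)%E.
Proof. by move=> mA; rewrite solid_angle_cone muleA -EFinM mulVf ?mul1e. Qed.

Lemma volume_cone b A : 0 <= b -> measurable A ->
  (volume (cone b A) = (b ^+ 3 / 3)%:E * solid_angle A)%E.
Proof.
rewrite le_eqVlt => /predU1P[<- mA|b0 mA].
  rewrite expr0n/= !mul0r mul0e (_ : cone _ _ = set0) ?measure0//.
  by apply/seteqP; split => y //= [/andP[/lt_le_trans /[apply]]]; rewrite ltxx.
have -> : cone b A = (fun y => b^-1 *: (y - 0)) @^-1` (cone 1 A).
  have bE (n : R) : (0 < b^-1 * n <= 1) = (0 < n <= b).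
    by rewrite pmulr_rgt0 ?invr_gt0// ler_pdivrMl// mulr1.
  have bV : 0 < b^-1 by rewrite invr_gt0.
  by apply/seteqP; split => y; rewrite /cone/= subr0 direction_scale// norm3Z ?(ltW bV)// bE.
rewrite volume_affine//; last exact: measurable_cone.
by rewrite volume_cone1// muleA -EFinM.
Qed.

(** The cone of height 1 over [A] lies in the cube of side 2 around the origin. *)
Lemma solid_angle_fin : fin_num_fun (@solid_angle R).
Proof.
move=> A mA; rewrite ge0_fin_numE//.
rewrite solid_angle_cone lte_mul_pinfty//.
pose I : set (measurableTypeR R) := `[(-1)%R, 1%R]%classic.
have mI : measurable I by exact: measurable_itv.
apply: (@le_lt_trans _ _ (@volume R ((I `*` I) `*` I))).
  apply: le_measure; rewrite ?inE; [exact: measurable_cone|by apply: measurableX => //; apply: measurableX|].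
  have Ile (t s : R) : t ^+ 2 <= s -> Num.sqrt s <= 1 -> -1 <= t <= 1.
    move=> ts s1; rewrite -ler_norml -(sqrtr_sqr t); apply: le_trans s1; exact: ler_wsqrtr.
  move=> y [/andP[_]]; rewrite /norm3 => y1 _.
  by split; [split|]; rewrite /I/= in_itv/=; apply: Ile y1;
     have := sqr_ge0 y.1.1; have := sqr_ge0 y.1.2; have := sqr_ge0 y.2; lra.
have E3 : (volume ((I `*` I) `*` I) = plane_area (I `*` I) * lebesgue_measure I)%E.
  exact: (product_measure1E (@plane_area R) lebesgue_measure (measurableX mI mI) mI).
by rewrite E3 plane_area_square// /I lebesgue_measure_itv/= lte_fin (_ : -1 < 1 :> R)%R ?ltrN10// -EFinB -!EFinM ltry.
Qed.

HB.instance Definition _ := Measure_isFinite.Build _ _ _ (@solid_angle R) solid_angle_fin.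

End polar.

Section polar_coordinates.
Context {R : realType}.
Implicit Types (c x : R3 R) (A E : set (R3 R)).

(* For B = ]x, +oo[ this is the scaling of cones; these sets generate the Borel
   sets of the line. *)
Lemma volume_cone_radial (b : R) A (B : set (measurableTypeR R)) :
  measurable A -> measurable B ->
  (volume (cone b A `&` @norm3 R @^-1` B) = solid_angle A * radial_measure b B)%E.
Proof.
move=> mA mB.
have aA : 0 <= fine (solid_angle A) by rewrite fine_ge0.
have faA : (fine (solid_angle A))%:E = solid_angle A by rewrite fineK// solid_angle_fin.
have mn : measurable_fun setT (@norm3 R : R3 R -> measurableTypeR R) by exact: measurable_norm3.
pose m1 : {measure set (measurableTypeR R) -> \bar R} :=
  measure_function_pushforward__canonical__measure_function_Measure
    (mrestr (@volume R) (measurable_cone b mA)) mn.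
pose m2 : {measure set (measurableTypeR R) -> \bar R} :=
  mscale (NngNum aA) (radial_measure b).
suff E : m1 B = m2 B.
  by rewrite setIC -faA; exact: E.
have m1E (x : R) : 0 <= x <= b ->
    (volume (cone b A `\` cone x A) = ((b ^+ 3 - x ^+ 3) / 3)%:E * solid_angle A)%E.
  move=> /andP[x0 xb]; rewrite measureD//=; try exact: measurable_cone.
    have -> : cone b A `&` cone x A = cone x A.
      apply/setIidPr => y [/andP[y0 yx] Ay]; split => //.
      by rewrite y0 (le_trans yx).
    rewrite !volume_cone// ?(le_trans x0)// -faA -!EFinM -EFinB.
    by congr EFin; field.
  rewrite volume_cone// ?(le_trans x0)// -faA -EFinM; exact: ltry.
apply: (@measure_unique _ R (measurableTypeR R) (@RGenOInfty.G R)
  (fun n => `](- n%:R)%R, +oo[%classic) _ _ _ _ m1 m2) => //.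
- exact: RGenOInfty.measurableE.
- move=> _ _ [x ->] [y ->]; exists (Num.max x y).
  apply/seteqP; split => z /=; rewrite !in_itv/= !andbT gt_max; first by move=> [-> ->].
  by move=> /andP[].
- by move=> i; exists (- i%:R).
- apply/seteqP; split => // x _; exists (Num.truncn `|x|).+1 => //=.
  rewrite in_itv/= andbT ltrNl; apply: le_lt_trans (ler_norm _) _.
  by rewrite normrN truncnS_gt.
- move=> _ [x ->]; rewrite /m1 /m2 /= /mscale /= /pushforward /mrestr /radial_measure.
  have [bx|xb] := leP b x.
    rewrite (_ : _ `&` _ = set0); last first.
      apply/seteqP; split => // y [/=]; rewrite in_itv/= andbT => xy [/andP[_ yb] _].
      by have := lt_le_trans xy (le_trans yb bx); rewrite ltxx.
    rewrite measure0 (_ : _ `&` _ = set0) ?integral_set0 ?mule0//.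
    apply/seteqP; split => // y [/=]; rewrite !in_itv/= andbT => /andP[_ yb] xy.
    by have := lt_le_trans xy (le_trans yb bx); rewrite ltxx.
  have [b0|b0] := ltP b 0.
    rewrite (_ : _ `&` _ = set0); last first.
      apply/seteqP; split => // y [/= _] [/andP[y0 yb] _].
      by have := lt_le_trans y0 yb; rewrite ltNge (ltW b0).
    rewrite measure0 (_ : _ `&` _ = set0) ?integral_set0 ?mule0//.
    apply/seteqP; split => // y [/=]; rewrite !in_itv/= => /andP[y0 yb] _.
    by have := lt_le_trans y0 yb; rewrite ltNge (ltW b0).
  (* Norms are positive on the cone, so a negative [x] cuts out the same set as 0, and [cone x' A]
     has a known volume. *)
  pose x' := Num.max x 0.
  have x'0 : 0 <= x' by rewrite le_max lexx orbT.
  have x'b : x' <= b by rewrite ge_max (ltW xb).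
  have x'E (y : R) : 0 < y -> (x < y) = (x' < y).
    by move=> y0; rewrite gt_max y0 andbT.
  rewrite (_ : _ `&` _ = cone b A `\` cone x' A); last first.
    apply/seteqP; split => y /=; rewrite in_itv/= andbT.
      move=> [xy [/andP[y0 yb] Ay]]; split; first by split => //; rewrite y0.
      by move=> [/andP[_]]; rewrite leNgt -x'E// xy.
    move=> [[/andP[y0 yb] Ay] nC]; split; last by split => //; rewrite y0.
    by rewrite x'E// ltNge; apply/negP => yx'; apply: nC; split => //; rewrite y0.
  rewrite m1E ?x'0// (_ : _ `&` _ = `]x', b]%classic); last first.
    apply/seteqP; split => y /=; rewrite !in_itv/= andbT.
      by move=> [/andP[y0 ->]]; rewrite x'E// => ->.
    move=> /andP[x'y ->]; have y0 := le_lt_trans x'0 x'y.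
    by rewrite x'E// y0 x'y.
  by rewrite integral_sqr// faA muleC.
- move=> k; rewrite /m1 /= /pushforward /mrestr.
  apply: (@le_lt_trans _ _ (volume (cone b A))).
    apply: le_measure; rewrite ?inE.
    + apply: measurableI; last exact: measurable_cone.
      by rewrite -[X in measurable X]setTI; exact: (mn).
    + exact: measurable_cone.
    + exact: subIsetr.
  have [b0|b0] := leP 0 b.
    by rewrite volume_cone// -faA -EFinM ltry.
  rewrite (_ : cone _ _ = set0) ?measure0//.
  apply/seteqP; split => // y [/andP[y0 yb] _].
  by have := lt_le_trans y0 yb; rewrite ltNge (ltW b0).
Qed.

End polar_coordinates.

Section polar_formula.
Context {R : realType}.
Implicit Types (c x : R3 R) (A E : set (R3 R)).

Definition polar (x : R3 R) : R3 R * measurableTypeR R := (direction x, norm3 x).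

Lemma measurable_ray c :
  measurable_fun setT (fun z : R3 R * measurableTypeR R => ray c z.1 z.2).
Proof.
have mS (i : R3 R -> measurableTypeR R) : measurable_fun setT i -> forall a : R,
    measurable_fun setT (fun z : R3 R * measurableTypeR R => a + z.2 * i z.1 : measurableTypeR R).
  move=> mi a; apply: measurable_funD => //; apply: measurable_funM => //.
  by apply: measurableT_comp => //; exact: measurable_fst.
apply: measurable_fun_pair; first apply: measurable_fun_pair.
- apply: (mS (fun x : R3 R => x.1.1) _ c.1.1).
  exact: (measurableT_comp measurable_fst measurable_fst).
- apply: (mS (fun x : R3 R => x.1.2) _ c.1.2).
  exact: (measurableT_comp measurable_snd measurable_fst).
- apply: (mS (fun x : R3 R => x.2) _ c.2).
  exact: measurable_snd.
Qed.

(** By [volume_cone_radial], the image under [polar] of the volume of the ball of radius [b] agrees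
    with the product on rectangles; uniqueness of the product measure does the rest. *)
Lemma product_solid_angle_radial (b : R) (X : set (R3 R * measurableTypeR R)) :
  measurable X ->
  ((@solid_angle R \x radial_measure b) X = volume (cone b setT `&` polar @^-1` X))%E.
Proof.
move=> mX.
have mn : measurable_fun setT polar.
  by apply: measurable_fun_pair; [exact: measurable_direction|exact: measurable_norm3].
pose m' : {measure set (R3 R * measurableTypeR R) -> \bar R} :=
  measure_function_pushforward__canonical__measure_function_Measure
    (mrestr (@volume R) (measurable_cone b (@measurableT _ (R3 R)))) mn.
rewrite (@product_measure_unique _ _ _ _ R (@solid_angle R) (radial_measure b) m') => //.
  by rewrite /m' /= /pushforward /mrestr setIC.
move=> A B mA mB; rewrite -[RHS]volume_cone_radial//.
rewrite /m' /= /pushforward /mrestr; congr volume.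
by apply/seteqP; split => y; rewrite /cone/= => -[[]]; tauto.
Qed.

(** For unit vectors and positive radii, norm and direction of [y - c] recover the two arguments of
    [ray]. A shell thus becomes a preimage, which gives its measurability. *)
Lemma shell_coneE c A (I : set R) : I `<=` `]0, +oo[ -> A `<=` sphere ->
  shell c A I = [set y | I (norm3 (y - c)) /\ A (direction (y - c))].
Proof.
move=> I0 AS; apply/seteqP; split => y.
  move=> [x Ax [r Ir]] <-.
  have r0 : 0 < r by have := I0 _ Ir; rewrite /= in_itv/= andbT.
  rewrite /= /ray (addrC c) addrK norm3Z ?(ltW r0)// direction_scale//.
  have x1 : norm3 x = 1 := AS _ Ax.
  by rewrite x1 mulr1 /direction x1 invr1 scale1r.
move=> [Iy Ay]; exists (direction (y - c)) => //; exists (norm3 (y - c)) => //.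
have y0 := I0 _ Iy; rewrite /= in_itv/= andbT in y0.
by rewrite /ray directionK// (addrC c) subrK.
Qed.

Lemma measurable_shell c A (I : set (measurableTypeR R)) :
  I `<=` `]0%R, +oo[ -> A `<=` sphere -> measurable I -> measurable A ->
  measurable (shell c A I).
Proof.
move=> I0 AS mI mA; rewrite shell_coneE//.
have mc : measurable_fun setT (fun y : R3 R => y - c).
  apply: measurable_fun_pair; first apply: measurable_fun_pair; apply: measurable_funB => //.
  - exact: (measurableT_comp measurable_fst measurable_fst).
  - exact: (measurableT_comp measurable_snd measurable_fst).
have -> : [set y | I (norm3 (y - c)) /\ A (direction (y - c))] =
    (fun y => y - c) @^-1` ((@norm3 R @^-1` I) `&` (direction @^-1` A)) by [].
rewrite -[X in measurable X]setTI; apply: mc => //; apply: measurableI.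
- by rewrite -[X in measurable X]setTI; exact: measurable_norm3.
- by rewrite -[X in measurable X]setTI; exact: measurable_direction.
Qed.

Lemma itv_gt0 (a b : R) (b1 : bool) : 0 < a ->
  [set` Interval (BLeft a) (BSide b1 b)] `<=` `]0, +oo[.
Proof.
move=> a0 x; rewrite /= !in_itv/= andbT.
by case: b1 => /andP[/(lt_le_trans a0)].
Qed.

Lemma polar_coordinates c A E (a b : R) :
  0 < a -> A `<=` sphere -> measurable A -> measurable E ->
  volume (E `&` shell c A `[a, b[) =
  (\int[solid_angle]_(x in A) \int[lebesgue_measure]_(r in `[a, b[)
     ((r ^+ 2 * \1_E (ray c x r))%:E))%E.
Proof.
move=> a0 AS mA mE.
pose X : set (R3 R * measurableTypeR R) :=
  (A `*` `[a, b[) `&` (fun z => ray c z.1 z.2) @^-1` E.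
have mX : measurable X.
  apply: measurableI; first by apply: measurableX => //; exact: measurable_itv.
  by rewrite -[X in measurable X]setTI; exact: measurable_ray.
have := product_solid_angle_radial b mX.
have -> : (@solid_angle R \x radial_measure b)%E X = (\int[solid_angle]_(x in A)
   \int[lebesgue_measure]_(r in `[a, b[) ((r ^+ 2 * \1_E (ray c x r))%:E))%E.
  rewrite /product_measure1/= [RHS]integral_mkcond/=; apply: eq_integral => x _.
  rewrite /radial_measure patchE; case: ifPn; rewrite (inE, notin_setE) => Ax.
    rewrite integral_mkcond [RHS]integral_mkcond; apply: eq_integral => r _.
    rewrite !patchE indicE.
    have -> : (r \in (`]0%R, b] `&` xsection X x)) =
        (r \in [set` `[a, b[]) && (ray c x r \in E).
      apply/idP/andP; rewrite !inE.
        by move=> [_]; rewrite /xsection/= inE => -[[_ /= rab]] Er.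
      move=> -[rab Er]; split.
        by move: rab; rewrite /= !in_itv/= => /andP[/(lt_le_trans a0) -> /ltW].
      by rewrite /xsection/= inE.
    by case: (r \in [set` `[a, b[]) => //=; case: (_ \in E); rewrite ?mulr1 ?mulr0.
  rewrite (_ : xsection X x = set0) ?setI0 ?integral_set0//.
  by apply/seteqP; split => // r; rewrite /xsection/= inE => -[[]].
move=> ->.
set S := cone b setT `&` polar @^-1` X.
have mS : measurable S.
  apply: measurableI; first exact: measurable_cone.
  rewrite -[X in measurable X]setTI.
  suff: measurable_fun setT polar by exact.
  by apply: measurable_fun_pair; [exact: measurable_direction|exact: measurable_norm3].
(* [S] has its apex at the origin; scaling by 1 is the translation that takes it to [c]. *)
have := @volume_affine R c 1 ltr01 S mS.
rewrite expr1n mul1e => <-; congr volume.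
rewrite shell_coneE//; last exact: itv_gt0.
apply/seteqP; split => y; rewrite /S /X /cone /polar/= invr1 scale1r in_itv/=.
  move=> [Ey [/andP[ya yb] Ay]]; have y0 := lt_le_trans a0 ya.
  by rewrite y0 (ltW yb) ya yb /ray directionK// (addrC c) subrK.
move=> [[/andP[y0 _] _] [[Ay yab]]]; rewrite /ray directionK// (addrC c) subrK => Ey.
by split => //; split.
Qed.

End polar_formula.

(** * Measurability and exchange on a ray *)

(** The measurable sets of [R3] are those of a product, so [U] is written as a countable union of
    boxes with rational centers. Half of [e] pays for the distance from [x] to the center, half for
    the size of the box. *)
Lemma open_measurable_R3 {R : realType} (U : set (R3 R)) : open U -> measurable U.
Proof.
move=> oU.
pose box (p : rat * rat * rat * nat) : set (R3 R) :=
  (ball (ratr p.1.1.1 : R) p.2.+1%:R^-1 `*` ball (ratr p.1.1.2 : R) p.2.+1%:R^-1)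
   `*` ball (ratr p.1.2 : R) p.2.+1%:R^-1.
have -> : U = \bigcup_p (if `[< box p `<=` U >] then box p else set0).
  apply/seteqP; split => [x Ux|x [p _]]; last by case: asboolP => // pU /pU.
  have /nbhs_ballP[e /= e0 eU] : nbhs x U by exact: open_nbhs_nbhs.
  have e20 : 0 < e / 2 by rewrite divr_gt0.
  near \oo => n.
  have ne : n.+1%:R^-1 < e / 2 :> R by near: n; exact: near_infty_natSinv_lt (PosNum e20).
  set d : R := n.+1%:R^-1 in ne.
  have d0 : 0 < d by rewrite invr_gt0.
  have rd (y : R) : exists q : rat, `|ratr q - y| < d.
    have : y - d < y + d by lra.
    move=> /rat_in_itvoo[q]; rewrite in_itv/= => /andP[q1 q2].
    by exists q; rewrite ltr_norml; apply/andP; split; lra.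
  have [q1 hq1] := rd x.1.1; have [q2 hq2] := rd x.1.2; have [q3 hq3] := rd x.2.
  have bU : box (q1, q2, q3, n) `<=` U.
    move=> y [[b1 b2] b3]; apply: eU.
    have tri (a b z : R) : `|a - b| < d -> ball (a : R) d z -> ball (b : R) e z.
      rewrite -ball_normE/= /ball_/= => h1 h2.
      by rewrite (_ : b - z = (a - z) - (a - b)); [apply: le_lt_trans (ler_normB _ _) _; lra|ring].
    by split; [split|]; [exact: tri hq1 b1|exact: tri hq2 b2|exact: tri hq3 b3].
  exists (q1, q2, q3, n) => //; case: asboolP => // _.
apply: countable_bigcupT_measurable => // p; case: ifP => // _.
by apply: measurableX; [apply: measurableX|]; exact: measurable_ball.
Unshelve. all: by end_near. Qed.

Section measurable_logarithms.
Context {R : realType} {d : measure_display} {T : measurableType d}.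
Implicit Types (D : set T) (p : T -> R).

Lemma measurable_lne_EFin : measurable_fun setT (fun u : R => lne u%:E).
Proof.
rewrite (_ : (fun _ => _) = (fun u => if u <= 0 then -oo%E else (ln u)%:E))//.
apply: measurable_fun_ifT => //.
  by apply: measurable_fun_ler.
by apply/measurable_EFinP; exact: measurable_ln.
Qed.

Lemma logitE p x : logit p x =
  if p x == 1 then +oo%E
  else if (0 < p x) && (p x < 1) then (ln (p x) - ln (1 - p x))%:E else -oo%E.
Proof.
rewrite /logit; have [->|p1] := eqVneq (p x) 1.
  by rewrite subrr inve0 mul1e.
rewrite inver subr_eq0 eq_sym (negbTE p1) -EFinM.
case: ifPn => [/andP[p0 p1']|].
  by rewrite lne_EFin ?divr_gt0 ?subr_gt0// ln_div// posrE// subr_gt0.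
rewrite negb_and -!leNgt => p01; rewrite le0_lneNy// lee_fin.
case/orP: p01 => h; first by rewrite mulr_le0_ge0// invr_ge0 subr_ge0 (le_trans h).
by rewrite mulr_ge0_le0 ?(le_trans _ h)// invr_le0 subr_le0.
Qed.

Lemma measurable_logit D p : measurable_fun D p -> measurable_fun D (logit p).
Proof.
move=> mp; have -> : logit p = (fun u : R => if u == 1 then +oo%E
    else if (0 < u) && (u < 1) then (ln u - ln (1 - u))%:E else -oo%E) \o p.
  by apply/funext => x; rewrite logitE.
apply: measurableT_comp => //; apply: measurable_fun_ifT => //.
  exact: measurable_fun_eqr.
apply: measurable_fun_ifT => //.
  by apply: measurable_and; apply: measurable_fun_ltr.
apply/measurable_EFinP; apply: measurable_funB; first exact: measurable_ln.
apply: measurableT_comp; first exact: measurable_ln.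
exact: measurable_funB.
Qed.
End measurable_logarithms.

(** The integral of [f] may be [-oo]. Comparing positive and negative parts separately asks for
    integrability of the upper bound only. *)
Lemma le_integral_integrable_ub {d} {T : measurableType d} {R : realType}
    (mu : {measure set T -> \bar R}) (D : set T) (f h : T -> \bar R) :
  measurable D -> measurable_fun D f -> mu.-integrable D h ->
  {ae mu, forall x, D x -> (f x <= h x)%E} ->
  (\int[mu]_(x in D) f x <= \int[mu]_(x in D) h x)%E.
Proof.
move=> mD mf ih fh; have mh := measurable_int _ ih.
rewrite integralE [leRHS]integralE; apply: leeB.
  apply: ae_ge0_le_integral => //; [exact: measurable_funepos|exact: measurable_funepos|].
  apply: filterS fh => x /[apply] fhx; rewrite !funeposE.
  by rewrite ge_max !le_max lexx orbT andbT fhx.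
apply: ae_ge0_le_integral => //; [exact: measurable_funeneg|exact: measurable_funeneg|].
apply: filterS fh => x /[apply] fhx; rewrite !funenegE.
by rewrite ge_max !le_max lexx orbT andbT leeN2 fhx.
Qed.

Lemma integral_cells {R : realType} (f : R -> \bar R) (r : nat -> R) (n : nat) :
  (forall i, (i < n)%N -> r i < r i.+1) ->
  measurable_fun `[r 0%N, r n[ f ->
  (\int[lebesgue_measure]_(x in `[r 0%N, r n[) f x =
   \sum_(i < n) \int[lebesgue_measure]_(x in `[r i, r i.+1[) f x)%E.
Proof.
elim: n => [|n IH] hr mf.
  by rewrite big_ord0 set_itv_ge ?integral_set0// bnd_simp ltxx.
have r0n : r 0%N <= r n.
  elim: n hr {mf IH} => // n IH hr.
  by apply: le_trans (ltW (hr n _)) => //; apply: IH => i /ltnW; exact: hr.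
have rn : r n <= r n.+1 by rewrite ltW// hr.
have E : `[r 0%N, r n.+1[%classic = `[r 0%N, r n[ `|` `[r n, r n.+1[ :> set R.
  by rewrite -itv_bndbnd_setU// ?bnd_simp.
rewrite big_ord_recr/= -IH//; last 2 first.
- by move=> i /ltnW; exact: hr.
- by apply: measurable_funS mf => //; rewrite E; exact: subsetUl.
rewrite E integral_setU//; first by rewrite -E.
rewrite disj_set2E; apply/eqP/seteqP; split => // x [] /=; rewrite !in_itv/= => /andP[_ x1] /andP[x2 _].
by have := lt_le_trans x1 x2; rewrite ltxx.
Qed.

Section bathtub.
Context {R : realType} (E : set (measurableTypeR R)) (a b rho : R).
Hypotheses (mE : measurable E) (a0 : 0 < a) (ar : a <= rho) (rb : rho <= b).
Notation mu := (@lebesgue_measure R).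
Let rho0 : 0 < rho. Proof. exact: lt_le_trans ar. Qed.
Notation I := (`[a, b[%classic : set (measurableTypeR R)).

Let minv (B : set (measurableTypeR R)) : measurable B ->
  measurable_fun I (fun r : R => (\1_B r / r)%:E).
Proof.
move=> mB; apply/measurable_EFinP; apply: measurable_funM => //.
have H : measurable_fun (`]0%R, +oo[%classic : set (measurableTypeR R)) (@GRing.inv R).
  apply: open_continuous_measurable_fun => // r.
  by rewrite inE/= in_itv/= andbT => r0; apply: inv_continuous; rewrite gt_eqF.
apply: measurable_funS H => // r /=.
by rewrite !in_itv/= andbT => /andP[/(lt_le_trans a0)].
Qed.

Let msqr (B : set (measurableTypeR R)) (k : R) : measurable B ->
  measurable_fun I (fun r : R => (k * (r ^+ 2 * \1_B r))%:E).
Proof.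
move=> mB; apply/measurable_EFinP; apply: measurable_funM => //.
by apply: measurable_funM => //; apply: measurable_funX; exact: measurable_id.
Qed.

Let iZ (B : set (measurableTypeR R)) : measurable B ->
 (\int[mu]_(r in I) ((rho ^- 3 * (r ^+ 2 * \1_B r))%:E) =
  (rho ^- 3)%:E * \int[mu]_(r in I) (r ^+ 2 * \1_B r)%:E)%E.
Proof.
move=> mB; under eq_integral do rewrite EFinM.
apply: ge0_integralZl_EFin => //.
- by move=> r _; rewrite lee_fin mulr_ge0 ?sqr_ge0.
- by have := msqr 1 mB; congr (measurable_fun _ _); apply/funext => r; rewrite mul1r.
- by rewrite invr_ge0 exprn_ge0 ?ltW.
Qed.

(* The kernel 1/r - rho^-3 r^2 is positive before rho and negative after it, so
   that filling the part of the ray before (after) rho is optimal. *)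
Let exchange (B C : set (measurableTypeR R)) : measurable B -> measurable C ->
  (forall r, a <= r < b -> \1_B r * (r^-1 - rho ^- 3 * r ^+ 2) <= \1_C r * (r^-1 - rho ^- 3 * r ^+ 2)) ->
  (\int[mu]_(r in I) (\1_B r / r)%:E + (rho ^- 3)%:E * \int[mu]_(r in I) (r ^+ 2 * \1_C r)%:E <=
   \int[mu]_(r in I) (\1_C r / r)%:E + (rho ^- 3)%:E * \int[mu]_(r in I) (r ^+ 2 * \1_B r)%:E)%E.
Proof.
move=> mB mC BC; rewrite -!iZ//.
have p1 (D : set (measurableTypeR R)) r : I r -> (0 <= (\1_D r / r)%:E)%E.
  rewrite /= in_itv/= => /andP[ra _]; rewrite lee_fin mulr_ge0// invr_ge0.
  by rewrite (le_trans (ltW a0)).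
have p2 (D : set (measurableTypeR R)) r : I r -> (0 <= (rho ^- 3 * (r ^+ 2 * \1_D r))%:E)%E.
  move=> _; rewrite lee_fin; apply: mulr_ge0; last by rewrite mulr_ge0// sqr_ge0.
  by rewrite invr_ge0 exprn_ge0 ?ltW.
rewrite -!ge0_integralD//; try (exact: minv); try (exact: msqr); try (exact: p1); try (exact: p2).
apply: ge0_le_integral => //.
- by move=> r Ir; rewrite adde_ge0// ?p1 ?p2.
- by apply: emeasurable_funD; [exact: minv|exact: msqr].
- by apply: emeasurable_funD; [exact: minv|exact: msqr].
- move=> r; rewrite /= in_itv/= => /BC H; rewrite -!EFinD lee_fin.
  set u := r^-1 in H *; set k := rho ^- 3 in H *; nra.
Qed.

Let ker_sign (r : R) : 0 < r ->
  (r <= rho -> 0 <= r^-1 - rho ^- 3 * r ^+ 2) /\ (rho <= r -> r^-1 - rho ^- 3 * r ^+ 2 <= 0).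
Proof.
move=> r0; have e : r^-1 - rho ^- 3 * r ^+ 2 = (rho ^+ 3 - r ^+ 3) * (r * rho ^+ 3)^-1.
  by field; rewrite !gt_eqF.
have p0 : 0 <= (r * rho ^+ 3)^-1 by rewrite invr_ge0 mulr_ge0 ?exprn_ge0 ?ltW.
rewrite e; split => h; [apply: mulr_ge0|apply: mulr_le0_ge0] => //.
  by rewrite subr_ge0 lerXn2r ?nnegrE ?(ltW r0) ?(ltW rho0).
by rewrite subr_le0 lerXn2r ?nnegrE ?(ltW r0) ?(ltW rho0).
Qed.

Let indic_itv_inv (s t : R) : a <= s -> s <= t -> t <= b ->
  (\int[mu]_(r in I) (\1_`[s, t[%classic r / r)%:E = (ln (t / s))%:E)%E /\
  (\int[mu]_(r in I) (r ^+ 2 * \1_`[s, t[%classic r)%:E = ((t ^+ 3 - s ^+ 3) / 3)%:E)%E.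
Proof.
move=> as_ st tb.
have sub : `[s, t[%classic `<=` I.
  by move=> r; rewrite /= !in_itv/= => /andP[/(le_trans as_) -> /lt_le_trans ->].
have patchI (f : R -> R) : (\int[mu]_(r in I) (f r * \1_`[s, t[%classic r)%:E =
    \int[mu]_(r in `[s, t[) (f r)%:E)%E.
  rewrite integral_mkcond [RHS]integral_mkcond; apply: eq_integral => r _.
  rewrite !patchE indicE; case: ifPn => rI; case: ifPn => rs; rewrite ?mulr1 ?mulr0//.
  by move: rI; rewrite notin_setE; case; apply: sub; rewrite inE in rs.
split; last by rewrite patchI integral_sqr.
under eq_integral do rewrite mulrC.
by rewrite patchI integral_inv// (lt_le_trans a0).
Qed.

(** The comparison set is [[a, rho[]. The radius [rho] need not match the mass of [E] on this ray:
    the mismatch survives with factor [rho ^- 3] and cancels only after integration over directions.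
    Terms are placed so that no extended reals are subtracted. *)
Lemma bathtub_le :
  (\int[mu]_(r in I) (\1_E r / r)%:E + (rho ^- 3)%:E * ((rho ^+ 3 - a ^+ 3) / 3)%:E <=
   (ln (rho / a))%:E + (rho ^- 3)%:E * \int[mu]_(r in I) (r ^+ 2 * \1_E r)%:E)%E.
Proof.
have [<- <-] := indic_itv_inv (lexx a) ar rb.
apply: exchange => // r /andP[ra _]; rewrite !indicE mem_setE in_itv/= ra/=.
have [h1 h2] := ker_sign (lt_le_trans a0 ra); have [rr|rr] := ltP r rho.
  by rewrite mul1r; case: (r \in E); rewrite ?mul1r ?mul0r// h1// ltW.
by rewrite mul0r; case: (r \in E); rewrite ?mul1r ?mul0r// h2.
Qed.

(** Here the comparison set is [[rho, b[], the far end of the cell, where a given mass contributes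
    least to the integral of [1/r]. *)
Lemma bathtub_ge :
  ((ln (b / rho))%:E + (rho ^- 3)%:E * \int[mu]_(r in I) (r ^+ 2 * \1_E r)%:E <=
   \int[mu]_(r in I) (\1_E r / r)%:E + (rho ^- 3)%:E * ((b ^+ 3 - rho ^+ 3) / 3)%:E)%E.
Proof.
have [<- <-] := indic_itv_inv ar rb (lexx b).
apply: exchange => // r /andP[ra rb']; rewrite !indicE mem_setE in_itv/= rb' andbT.
have [h1 h2] := ker_sign (lt_le_trans a0 ra); have [rr|rr] := leP rho r.
  by rewrite mul1r; case: (r \in E); rewrite ?mul1r ?mul0r// h2.
by rewrite mul0r; case: (r \in E); rewrite ?mul1r ?mul0r// h1// ltW.
Qed.

End bathtub.

(** * The program in the radii and its dual *)

Lemma ereal_real_between {R : realType} (x y : \bar R) : (x < y)%E ->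
  exists b : R, (x < b%:E)%E /\ (b%:E < y)%E.
Proof.
case: x => [s| |]; case: y => [t| |] //.
- by rewrite lte_fin => st; exists ((s + t) / 2); rewrite !lte_fin !midf_lt.
- by move=> _; exists (s + 1); rewrite lte_fin ltrDl ltry.
- by move=> _; exists (t - 1); rewrite ltNyr lte_fin gtrBl.
- by move=> _; exists 0; rewrite ltNyr ltry.
Qed.

(** If no maximum exists, the sets where [f] exceeds some [b] below the supremum generate a proper
    filter on [K], which clusters at some [p]. A majorant [g] of [f] that is continuous at [p], with
    [g p < b] for such a [b], contradicts this near [p]. *)
Lemma usc_attained {R : realType} {T : topologicalType} (K : set T) (f : T -> \bar R) :
  compact K -> K !=set0 ->
  (forall p, K p -> forall b : R, (f p < b%:E)%E -> exists g : T -> R,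
     [/\ {for p, continuous g}, g p < b & forall z, K z -> (f z <= (g z)%:E)%E]) ->
  exists2 p, K p & forall z, K z -> (f z <= f p)%E.
Proof.
move=> cK [k0 Kk0] usc; apply: contrapT => nomax.
pose M := ereal_sup (f @` K).
have fM z : K z -> (f z <= M)%E by move=> Kz; apply: ereal_sup_ubound; exists z.
have ltM p : K p -> (f p < M)%E.
  move=> Kp; rewrite lt_neqAle fM// andbT; apply/eqP => fpM.
  by apply: nomax; exists p => // z Kz; rewrite fpM fM.
have betw p : K p -> exists b : R, (f p < b%:E)%E /\ (b%:E < M)%E.
  by move=> /ltM; exact: ereal_real_between.
pose G := filter_from [set b : R | (b%:E < M)%E] (fun b => K `&` [set z | (b%:E < f z)%E]).
have PG : ProperFilter G.
  apply: filter_from_proper.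
    apply: filter_from_filter.
      by have [b [_ bM]] := betw _ Kk0; exists b.
    move=> b b' /= bM b'M; exists (Num.max b b') => /=.
      by rewrite EFin_max gt_max bM.
    by move=> z [Kz] /=; rewrite EFin_max gt_max => /andP[].
  move=> b /= bM; have [_ [z Kz <-] bz] := ereal_sup_gt bM.
  by exists z.
have GK : G K.
  have [b [_ bM]] := betw _ Kk0; exists b => //; exact: subIsetl.
have [p [Kp clp]] := cK G PG GK.
have [b [fpb bM]] := betw _ Kp.
have [g [cg gb fg]] := usc p Kp b fpb.
have GA : G (K `&` [set z | (b%:E < f z)%E]) by exists b.
have NB : nbhs p [set z | g z < b].
  have : nbhs (g p) [set z | z < b] by exact: lt_nbhsl.
  by move=> /cg.
have [z [[Kz bfz] gzb]] := clp _ _ GA NB.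
have := lt_le_trans bfz (fg z Kz); rewrite lte_fin ltNge => /negP; apply; exact: ltW.
Qed.

Section log_tangent.
Context {R : realType}.

Lemma ln_tangent (y t : R) : 0 < y -> 0 < t -> ln y <= ln t + y / t - 1.
Proof.
move=> y0 t0; have yt : 0 < y / t by rewrite divr_gt0.
have H : -1 < y / t - 1 by lra.
by have := le_ln1Dx H; rewrite addrC subrK ln_div//; lra.
Qed.

Lemma lne_tangent (y t : R) : 0 < t -> (lne y%:E <= (ln t + y / t - 1)%:E)%E.
Proof.
move=> t0; have [y0|y0] := leP y 0; first by rewrite le0_lneNy ?leNye// lee_fin.
by rewrite lne_EFin// lee_fin ln_tangent.
Qed.

Lemma mule_lne_tangent (q y t : R) : 0 <= q -> 0 < t ->
  (q%:E * lne y%:E <= (q * (ln t + y / t - 1))%:E)%E.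
Proof. by move=> q0 t0; rewrite EFinM lee_wpmul2l ?lee_fin ?lne_tangent. Qed.

(** Tangents recover the logarithm in the limit. The best one is at [y] when [y > 0]; at [y = 0]
    with [q > 0] the infimum is [-oo] and not attained, hence the formulation with a strict bound
    [b]. *)
Lemma mule_lne_inf (q y b : R) : 0 <= q -> 0 <= y -> (q%:E * lne y%:E < b%:E)%E ->
  exists2 t, 0 < t & q * (ln t + y / t - 1) < b.
Proof.
rewrite le_eqVlt => /predU1P[<-|q0].
  by rewrite mul0e lte_fin => _ b0; exists 1; rewrite ?mul0r.
rewrite le_eqVlt => /predU1P[<-|y0].
  (* At [y = 0] the tangent has value [q * (ln t - 1)], which this [t] makes equal to [b - q]. *)
  move=> _; exists (expR (b / q)); first exact: expR_gt0.
  rewrite mul0r addr0 expRK mulrBr mulr1 mulrCA divff ?gt_eqF// mulr1.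
  by rewrite gtrBl.
rewrite lne_EFin// -EFinM lte_fin => h; exists y => //.
by rewrite divff ?gt_eqF// addrK.
Qed.

End log_tangent.

(** * The function F as a lower envelope of affine functions *)

Section summary_affine.
Context {R : realType} (dmax : R) (m : nat) (Y : int -> R) (w : R).
Hypotheses (dmax0 : 0 < dmax) (m0 : (0 < m)%N).

(* The signed index k of a summary is u - m. *)
Definition nat_summary (u : nat) : R := Y (u%:Z - m%:Z).
Local Notation y := nat_summary.

Definition threshold (u : nat) : R := (u%:Z - m%:Z)%:~R * dmax / m%:R.
(** For a summary of a set of measure [w], [w - y s] is the measure where the logit reaches
    [threshold s]. Hence this is the integral of the positive part of the logit, rounded up to the
    next threshold, minus [threshold u]. *)
Definition excess (u : nat) : R := dmax / m%:R * \sum_(u <= s < m.*2) (w - y s).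

Definition regular_summary : Prop :=
  (forall u v, (u <= v <= m.*2)%N -> y u <= y v) /\ y m.*2 = w.

Hypothesis regY : regular_summary.

(** Abel summation: weights [k + 1] on the increments of the summary become unit weights on the
    tails [w - y s], with no boundary term at the top since [y m.*2 = w]. *)
Let summation_by_parts (u : nat) (S : R) : (u <= m.*2)%N ->
  \sum_(u <= t < m.*2) (y t.+1 - y t) * (t%:Z - m%:Z + 1)%:~R
    + (u%:Z - m%:Z)%:~R * (y u - w + S) =
  (u%:Z - m%:Z)%:~R * S + \sum_(u <= s < m.*2) (w - y s).
Proof.
move=> um; rewrite -(subKn um); elim: (m.*2 - u)%N (leq_subr u m.*2) => [_|n IH nm].
  by rewrite subn0 !big_geq// (proj2 regY) subrr !add0r addr0.
have := IH (ltnW nm).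
set v := (m.*2 - n.+1)%N; have -> : (m.*2 - n)%N = v.+1 by rewrite /v subnSK.
have vm : (v < m.*2)%N by rewrite /v ltn_subrL/= (leq_trans _ nm).
rewrite [in X in _ -> X](big_ltn vm) [in X in _ -> _ = X](big_ltn vm).
have -> : (v.+1%:Z - m%:Z)%:~R = (v%:Z - m%:Z)%:~R + 1 :> R.
  by rewrite !intrB -!pmulrn -natr1; ring.
rewrite [(_ - _ + 1)%:~R]intrD.
set s1 := \sum_(_ <= _ < _) _; set s2 := \sum_(_ <= _ < _) _; set k := (_ - _)%:~R.
by rewrite mulr1z => /(canRL (addrK _)) ->; ring.
Qed.

(** From line [v] to line [v.+1] the value changes by [dmax / m * (S - w + y v)]. As [y] is
    nondecreasing, this is negative before the first [v] with [w - S <= y v] and nonnegative from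
    there on. That index is the one in [J], so its line is the lowest. *)
Lemma F_affine (S : R) : 0 <= S <= w ->
  (forall u, (u <= m.*2)%N -> F dmax m Y w S <= threshold u * S + excess u) /\
  exists2 u, (u <= m.*2)%N & F dmax m Y w S = threshold u * S + excess u.
Proof.
move=> /andP[S0 Sw].
pose P (t : 'I_(m.*2.+1)) := w - S <= y t.
have Pmax : P ord_max by rewrite /P (proj2 regY)/=; lra.
case: (@arg_minnP _ (ord_max : 'I_(m.*2.+1)) P (fun t => t : nat) Pmax) => t0 Pt0 mint0.
have JE : J m Y w S = t0%:Z - m%:Z.
  rewrite /J; congr (_ - _); congr Posz.
  by case: arg_minnP => // t1 Pt1 mint1; apply/eqP; rewrite eqn_leq mint0// mint1.
have t0m : (t0 <= m.*2)%N by rewrite -ltnS.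
have FE : F dmax m Y w S = threshold t0 * S + excess t0.
  have := summation_by_parts S t0m.
  rewrite /F JE -/(y t0) => E.
  have -> : \sum_(t < m.*2 | t0%:Z - m%:Z <= t%:Z - m%:Z)
      (Y (t%:Z - m%:Z + 1) - Y (t%:Z - m%:Z)) * (t%:Z - m%:Z + 1)%:~R =
    \sum_(t0 <= t < m.*2) (y t.+1 - y t) * (t%:Z - m%:Z + 1)%:~R.
    rewrite -(big_mkord (fun t : nat => t0%:Z - m%:Z <= t%:Z - m%:Z)
       (fun t : nat => (Y (t%:Z - m%:Z + 1) - Y (t%:Z - m%:Z)) * (t%:Z - m%:Z + 1)%:~R)).
    rewrite (big_cat_nat (leq0n t0) t0m)/= big_nat_cond big1 ?add0r; last first.
      by move=> i /andP[/andP[_ it]]; rewrite lerD2r lez_nat leqNgt it.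
    rewrite big_nat_cond [RHS]big_nat_cond; apply: eq_big => i.
      by rewrite lerD2r lez_nat; case: (leqP t0 i) => //=; rewrite andbT.
    by move=> _; rewrite /nat_summary; congr ((Y _ - _) * _); rewrite intS (addrC 1) addrAC.
  transitivity (dmax / m%:R * ((t0%:Z - m%:Z)%:~R * S + \sum_(t0 <= s < m.*2) (w - y s))).
    by congr (_ * _); exact: E.
  by rewrite /threshold /excess; field; rewrite pnatr_eq0 -lt0n.
split; last by exists t0.
move=> u um; rewrite FE.
have step v : (v < m.*2)%N -> threshold v.+1 * S + excess v.+1 =
    threshold v * S + excess v + dmax / m%:R * (S - w + y v).
  move=> vm; rewrite /excess (big_ltn vm) /threshold.
  have -> : (v.+1%:Z - m%:Z)%:~R = (v%:Z - m%:Z)%:~R + 1 :> R.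
    by rewrite !intrB -!pmulrn -natr1; ring.
  by field; rewrite pnatr_eq0 -lt0n.
have dm0 : 0 <= dmax / m%:R by rewrite divr_ge0 ?ler0n ?(ltW dmax0).
case/orP: (leq_total t0 u) => tu.
  rewrite -(subnKC tu); elim: (u - t0)%N (leq_sub2r t0 um) => [_|n IH nm].
    by rewrite addn0.
  apply: le_trans (IH (ltnW nm)) _; rewrite addnS.
  have lt : (t0 + n < m.*2)%N by rewrite -ltn_subRL.
  rewrite step// lerDl mulr_ge0//.
  have := proj1 regY t0 (t0 + n)%N; rewrite leq_addr (ltnW lt) => /(_ isT).
  by move: Pt0; rewrite /P; lra.
rewrite -(subKn tu); elim: (t0 - u)%N (leq_subr u t0) => [_|n IH nt].
  by rewrite subn0.
apply: le_trans (IH (ltnW nt)) _.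
set v := (t0 - n.+1)%N; have -> : (t0 - n)%N = v.+1 by rewrite /v subnSK.
have vt : (v < t0)%N by rewrite /v ltn_subrL/= (leq_trans _ nt).
have vm := leq_trans vt t0m.
rewrite step// gerDl mulr_ge0_le0//.
have : ~~ (w - S <= y v).
  apply/negP => h; have vm' : (v < m.*2.+1)%N by rewrite ltnW.
  by have := mint0 (Ordinal vm') h; rewrite leqNgt vt.
by rewrite -ltNge; lra.
Qed.

End summary_affine.

(** * Radii and volumes of layers *)

Section radii.
Context {R : realType}.
Implicit Types a V rho s t : R.

Lemma exp3_inj : injective (fun x : R => x ^+ 3).
Proof.
move=> x y /= xy; have E : (x - y) * (x ^+ 2 + x * y + y ^+ 2) = 0.
  by rewrite -(subrr (y ^+ 3)) -[in X in _ = X - _]xy; ring.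
move/eqP: E; rewrite mulf_eq0 subr_eq0 => /orP[/eqP //|/eqP E].
have y0 : y = 0.
  by apply/eqP; rewrite -sqrf_eq0; apply/eqP; have := sqr_ge0 (2 * x + y); have := sqr_ge0 y; nra.
have x0 : x = 0.
  by apply/eqP; rewrite -sqrf_eq0; apply/eqP; rewrite y0 in E; rewrite -E; ring.
by rewrite x0.
Qed.

Lemma outer_radius_Upsilon a s rho : a != 0 -> outer_radius a s (Upsilon a s rho) = rho.
Proof.
move=> a0; rewrite /outer_radius; case: xgetP => [x _ /= xE|/(_ rho)[]//].
apply: exp3_inj => /=; have a3 : a / 3 != 0 by rewrite mulf_neq0.
by move: xE; rewrite /Upsilon => /(mulfI a3) /addIr.
Qed.

Lemma inner_radius_Upsilon a t rho : a != 0 -> inner_radius a t (Upsilon a rho t) = rho.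
Proof.
move=> a0; rewrite /inner_radius; case: xgetP => [x _ /= xE|/(_ rho)[]//].
apply: exp3_inj => /=; have a3 : a / 3 != 0 by rewrite mulf_neq0.
by move: xE; rewrite /Upsilon => /(mulfI a3) /addrI /oppr_inj.
Qed.

Let cube_root_itv s t x : 0 < s -> s <= t -> s ^+ 3 <= x <= t ^+ 3 ->
  exists2 rho, s <= rho <= t & rho ^+ 3 = x.
Proof.
move=> s0 st /andP[sx xt].
have x0 : 0 < x by apply: lt_le_trans sx; rewrite exprn_gt0.
have t0 := lt_le_trans s0 st.
have E : (x `^ (3^-1)) ^+ 3 = x.
  by rewrite -powR_mulrn ?powR_ge0// -powRrM mulVf// powRr1 ?ltW.
have p0 := powR_ge0 x 3^-1.
exists (x `^ 3^-1) => //; apply/andP; split.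
  by rewrite -(@ler_pXn2r _ 3) ?nnegrE ?(ltW s0)// E.
by rewrite -(@ler_pXn2r _ 3) ?nnegrE ?(ltW t0)// E.
Qed.

Lemma Upsilon_outer_onto a s t V : 0 <= a -> 0 < s -> s <= t ->
  0 <= V <= Upsilon a s t -> exists2 rho, s <= rho <= t & V = Upsilon a s rho.
Proof.
move=> + s0 st; rewrite le_eqVlt => /predU1P[<-|a0].
  rewrite /Upsilon !mul0r => /le_anti <-; exists s; rewrite ?lexx//.
  by rewrite !mul0r.
rewrite /Upsilon => /andP[V0 V1].
have [|rho rhost E] := @cube_root_itv s t (s ^+ 3 + V / (a / 3)) s0 st.
  have a3 : 0 < a / 3 by rewrite divr_gt0.
  apply/andP; split; first by rewrite lerDl divr_ge0// ltW.
  by rewrite -lerBrDl ler_pdivrMr// mulrC.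
by exists rho => //; rewrite E; field; rewrite gt_eqF.
Qed.

(** An outer layer of volume [V] is what an inner layer of the complementary volume leaves free. *)
Lemma Upsilon_inner_onto a s t V : 0 <= a -> 0 < s -> s <= t ->
  0 <= V <= Upsilon a s t -> exists2 rho, s <= rho <= t & V = Upsilon a rho t.
Proof.
move=> a0 s0 st /andP[V0 V1].
have [|rho rhost E] := Upsilon_outer_onto a0 s0 st (V := Upsilon a s t - V).
  by rewrite subr_ge0 V1 gerBl.
exists rho => //; move: E; rewrite /Upsilon; lra.
Qed.

Lemma Upsilon_ge0 a s t : 0 <= a -> 0 < s -> s <= t -> 0 <= Upsilon a s t.
Proof.
move=> a0 s0 st; rewrite /Upsilon mulr_ge0 ?divr_ge0// subr_ge0.
by rewrite lerXn2r ?nnegrE// ?(ltW s0)// (le_trans (ltW s0)).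
Qed.

Lemma Upsilon_le a s t s' t' : 0 <= a -> 0 < s -> s <= s' -> s' <= t' -> t' <= t ->
  Upsilon a s' t' <= Upsilon a s t.
Proof.
move=> a0 s0 ss st tt; rewrite /Upsilon ler_wpM2l ?divr_ge0// lerB//.
  by rewrite lerXn2r ?nnegrE//; lra.
by rewrite lerXn2r ?nnegrE//; lra.
Qed.

End radii.

(** All that the optimization needs to know about [F]; it keeps summaries out of the next
    section. *)
Definition affine_inf {R : realType} (M : nat) (w : R) (f : R -> R) (A B : nat -> R) : Prop :=
  forall S, 0 <= S <= w -> (forall u, (u <= M)%N -> f S <= A u * S + B u) /\
    exists2 u, (u <= M)%N & f S = A u * S + B u.

(** * Duality and attainment for the program in the radii *)

Section radii_program.
Context {R : realType} (N M : nat) (area alpha kappa : R) (r : nat -> R).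
Context (f : R -> R) (A B : nat -> R) (g : 'I_N -> R -> R) (C D : 'I_N -> nat -> R).
Hypotheses (area0 : 0 <= area) (alpha0 : alpha < 0) (kappa0 : 0 <= kappa).
Hypotheses (r0 : forall i : 'I_N, 0 < r i) (rS : forall i : 'I_N, r i <= r i.+1).
Hypothesis fAB : affine_inf M area f A B.
Hypothesis gCD : forall i : 'I_N, affine_inf M (Upsilon area (r i) (r i.+1)) (g i) (C i) (D i).
Implicit Types (q : R) (rho : 'I_N -> R).

Definition log_ratio0 rho0 : R := \sum_(i < N) ln (r i.+1 / rho0 i).
Definition log_ratio1 rho1 : R := \sum_(i < N) ln (rho1 i / r i).
(** Volume of the extremal configuration in a cell: outside the segmentation the layer touches the
    far side of the cell, inside it touches the near side. *)
Definition filled q rho0 rho1 (i : 'I_N) : R :=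
  Upsilon (area - q) (rho0 i) (r i.+1) + Upsilon q (r i) (rho1 i).

Definition gamma_radii q rho0 rho1 : \bar R :=
  (((area - q) * (alpha * log_ratio0 rho0))%:E
   + q%:E * lne (1 - expR (alpha * log_ratio1 rho1))%:E
   + (kappa * \sum_(i < N) g i (filled q rho0 rho1 i))%:E)%E.

Definition primal q rho0 rho1 : \bar R := ((f q)%:E + gamma_radii q rho0 rho1)%E.

(* u and v are the multipliers of the area and volume constraints, t is the point
   of tangency to ln. *)
Definition dual (u : nat) (v : 'I_N -> nat) (t : R) q rho0 rho1 : R :=
  A u * q + B u +
  ((area - q) * (alpha * log_ratio0 rho0)
   + q * (ln t + (1 - expR (alpha * log_ratio1 rho1)) / t - 1)
   + kappa * \sum_(i < N) (C i (v i) * filled q rho0 rho1 i + D i (v i))).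

Definition in_cells rho := forall i : 'I_N, r i <= rho i <= r i.+1.

Lemma filled_itv q rho0 rho1 i : 0 <= q <= area -> in_cells rho0 -> in_cells rho1 ->
  0 <= filled q rho0 rho1 i <= Upsilon area (r i) (r i.+1).
Proof.
move=> /andP[q0 qa] /(_ i)/andP[h1 h2] /(_ i)/andP[h3 h4].
have qa' : 0 <= area - q by rewrite subr_ge0.
rewrite addr_ge0 ?Upsilon_ge0// ?(lt_le_trans (r0 i))//=.
have E : Upsilon area (r i) (r i.+1) =
    Upsilon (area - q) (r i) (r i.+1) + Upsilon q (r i) (r i.+1) by rewrite /Upsilon; ring.
by rewrite E lerD// Upsilon_le.
Qed.

Lemma log_ratio1_ge0 rho1 : in_cells rho1 -> 0 <= log_ratio1 rho1.
Proof.
move=> h; apply: sumr_ge0 => i _; have /andP[h1 _] := h i.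
by rewrite ln_ge0// ler_pdivlMr// mul1r.
Qed.

Lemma primal_le_dual u v t q rho0 rho1 : (u <= M)%N -> (forall i, (v i <= M)%N) -> 0 < t ->
  0 <= q <= area -> in_cells rho0 -> in_cells rho1 ->
  (primal q rho0 rho1 <= (dual u v t q rho0 rho1)%:E)%E.
Proof.
move=> uM vM t0 qa h0 h1; have /andP[q0 _] := qa.
rewrite /primal /gamma_radii /dual !EFinD.
apply: leeD; first by rewrite -EFinD lee_fin; apply: (proj1 (fAB qa)).
apply: leeD; last first.
  rewrite lee_fin ler_wpM2l// ler_sum// => i _.
  exact: (proj1 (gCD (filled_itv i qa h0 h1))).
apply: leeD => //; rewrite -!EFinD; exact: mule_lne_tangent.
Qed.

(** Absence of a duality gap. The multipliers [u] and [v] are optimal; for [t] a strict bound is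
    needed, since no tangent is optimal when the logarithm is [-oo]. *)
Lemma dual_lt_of_primal_lt b q rho0 rho1 :
  0 <= q <= area -> in_cells rho0 -> in_cells rho1 -> (primal q rho0 rho1 < b%:E)%E ->
  exists u v t, [/\ (u <= M)%N, forall i, (v i <= M)%N, 0 < t & dual u v t q rho0 rho1 < b].
Proof.
move=> qa h0 h1 Pb; have /andP[q0 _] := qa.
have [_ [u uM uE]] := fAB qa.
have /(_ _)/cid2 vP i := proj2 (gCD (filled_itv i qa h0 h1)).
pose X := (area - q) * (alpha * log_ratio0 rho0).
pose Z := kappa * \sum_(i < N) g i (filled q rho0 rho1 i).
(* Only the logarithmic term can be infinite, so it is isolated; its tangent at 1 excludes [+oo]. *)
have lb : (q%:E * lne (1 - expR (alpha * log_ratio1 rho1))%:E < (b - f q - X - Z)%:E)%E.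
  move: Pb; rewrite /primal /gamma_radii -/X -/Z.
  have : (q%:E * lne (1 - expR (alpha * log_ratio1 rho1))%:E < +oo)%E.
    by apply: le_lt_trans (mule_lne_tangent _ q0 ltr01) _; rewrite ltry.
  case: (_ * _)%E => [s _||_ _]//; last by rewrite ltNyr.
  by rewrite -!EFinD !lte_fin; lra.
have y0 : 0 <= 1 - expR (alpha * log_ratio1 rho1).
  by rewrite subr_ge0 -expR0 ler_expR mulr_le0_ge0 ?(ltW alpha0)// log_ratio1_ge0.
have [t t0 tb] := mule_lne_inf q0 y0 lb.
exists u, (fun i => s2val (vP i)), t; split => //; first by move=> i; exact: s2valP (vP i).
rewrite /dual -uE -/X.
have -> : kappa * \sum_(i < N) (C i (s2val (vP i)) * filled q rho0 rho1 i + D i (s2val (vP i))) = Z.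
  by congr (_ * _); apply: eq_bigr => i _; rewrite -(s2valP' (vP i)).
by move: tb; rewrite /X; lra.
Qed.

Lemma le_primal (x : \bar R) q rho0 rho1 :
  0 <= q <= area -> in_cells rho0 -> in_cells rho1 ->
  (forall u v t, (u <= M)%N -> (forall i, (v i <= M)%N) -> 0 < t ->
     (x <= (dual u v t q rho0 rho1)%:E)%E) ->
  (x <= primal q rho0 rho1)%E.
Proof.
move=> qa h0 h1 H; rewrite leNgt; apply/negP => /ereal_real_between[b [Pb bx]].
have [u [v [t [uM vM t0 db]]]] := dual_lt_of_primal_lt qa h0 h1 Pb.
by have := lt_le_trans bx (H u v t uM vM t0); rewrite lte_fin ltNge ltW.
Qed.

(** At each point [dual_lt_of_primal_lt] supplies the continuous majorant required by
    [usc_attained]. Radii are packed into row vectors for the compactness of the box. *)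
Lemma primal_attained : exists q rho0 rho1, [/\ 0 <= q <= area, in_cells rho0, in_cells rho1 &
  forall q' rho0' rho1', 0 <= q' <= area -> in_cells rho0' -> in_cells rho1' ->
    (primal q' rho0' rho1' <= primal q rho0 rho1)%E].
Proof.
pose K1 := [set v : 'rV[R]_N | forall i : 'I_N, `[r i, r i.+1]%classic (v ord0 i)].
have cK1 : compact K1.
  apply: (@rV_compact R N (fun i : 'I_N => `[r i, r i.+1]%classic)) => i.
  exact: segment_compact.
pose K : set (R * ('rV[R]_N * 'rV[R]_N)) := `[0, area]%classic `*` (K1 `*` K1).
have cK : compact K.
  by apply: compact_setX; [exact: segment_compact|exact: compact_setX].
have K1P (v : 'rV[R]_N) : K1 v -> in_cells (v ord0).
  by move=> h i; have := h i; rewrite /= in_itv.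
have K1r rho : in_cells rho -> K1 (\row_i rho i).
  by move=> h i; rewrite /= in_itv/= mxE.
have K10 : K1 (\row_i r i) by apply: K1r => i; rewrite lexx rS.
have [||] := @usc_attained R _ K (fun (z : R * ('rV[R]_N * 'rV[R]_N)) => primal z.1 (z.2.1 ord0) (z.2.2 ord0)) cK.
- by exists (0, (\row_i r i, \row_i r i)); split => //=; rewrite in_itv/= lexx.
- move=> [q [v0 v1]] [/= qa [/= Kv0 Kv1]] b; rewrite in_itv/= in qa.
  have h0 := K1P _ Kv0; have h1 := K1P _ Kv1.
  move=> /(dual_lt_of_primal_lt qa h0 h1)[u [v [t [uM vM t0 db]]]].
  exists (fun (z : R * ('rV[R]_N * 'rV[R]_N)) => dual u v t z.1 (z.2.1 ord0) (z.2.2 ord0)); split => //; last first.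
    move=> [q' [v0' v1']] [/= qa' [/= Kv0' Kv1']]; rewrite in_itv/= in qa'.
    by apply: primal_le_dual => //; exact: K1P.
  rewrite /prop_for /continuous_at /=.
  pose W := (R * ('rV[R]_N * 'rV[R]_N))%type.
  set p : W := (q, (v0, v1)).
  have c1 : z.1 @[z --> (p : W)] --> q by exact: cvg_fst.
  have c20 : z.2.1 @[z --> (p : W)] --> v0.
    by apply: (@cvg_comp _ _ _ snd fst _ (nbhs (v0, v1))); [exact: cvg_snd|exact: cvg_fst].
  have c21 : z.2.2 @[z --> (p : W)] --> v1.
    by apply: (@cvg_comp _ _ _ snd snd _ (nbhs (v0, v1))); [exact: cvg_snd|exact: cvg_snd].
  pose e0 (z : W) : 'I_N -> R := fun i => z.2.1 ord0 i.
  pose e1 (z : W) : 'I_N -> R := fun i => z.2.2 ord0 i.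
  have cv0 (i : 'I_N) : e0 z i @[z --> (p : W)] --> v0 ord0 i.
    exact: (cvg_comp _ _ c20 (@coord_continuous R 1 N ord0 i v0)).
  have cv1 (i : 'I_N) : e1 z i @[z --> (p : W)] --> v1 ord0 i.
    exact: (cvg_comp _ _ c21 (@coord_continuous R 1 N ord0 i v1)).
  have cU a' x' y' (fa fx fy : R * ('rV[R]_N * 'rV[R]_N) -> R) :
      fa z @[z --> (p : W)] --> a' -> fx z @[z --> (p : W)] --> x' -> fy z @[z --> (p : W)] --> y' ->
      Upsilon (fa z) (fx z) (fy z) @[z --> (p : W)] --> Upsilon a' x' y'.
    move=> ca cx cy; apply: cvgM; first by apply: cvgM => //; exact: cvg_cst.
    apply: cvgB; first exact: (cvg_comp _ _ cy (@exprn_continuous R 3 y')).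
    exact: (cvg_comp _ _ cx (@exprn_continuous R 3 x')).
  have cfill (i : 'I_N) : filled (fst z) (e0 z) (e1 z) i @[z --> (p : W)] -->
      filled q (v0 ord0) (v1 ord0) i.
    apply: cvgD; apply: cU => //; try exact: cvg_cst.
    by apply: cvgB => //; exact: cvg_cst.
  have csum (G : 'I_N -> R * ('rV[R]_N * 'rV[R]_N) -> R) (G0 : 'I_N -> R) :
      (forall i, G i z @[z --> (p : W)] --> G0 i) ->
      \sum_(i < N) G i z @[z --> (p : W)] --> \sum_(i < N) G0 i.
    by move=> cG; apply: cvg_big => //; exact: add_continuous.
  have cl0 : log_ratio0 (e0 z) @[z --> (p : W)] --> log_ratio0 (v0 ord0).
    apply: csum => i; have /andP[hi _] := h0 i; have vi := lt_le_trans (r0 i) hi.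
    have ri := lt_le_trans (r0 i) (rS i).
    have cq : r i.+1 / e0 z i @[z --> (p : W)] --> r i.+1 / v0 ord0 i.
      by apply: cvgM; [exact: cvg_cst|apply: cvgV => //; rewrite gt_eqF].
    by apply: (cvg_comp _ _ cq); apply: continuous_ln; rewrite divr_gt0.
  have cl1 : log_ratio1 (e1 z) @[z --> (p : W)] --> log_ratio1 (v1 ord0).
    apply: csum => i; have /andP[hi _] := h1 i; have vi := lt_le_trans (r0 i) hi.
    have cq : e1 z i / r i @[z --> (p : W)] --> v1 ord0 i / r i.
      by apply: cvgM => //; exact: cvg_cst.
    by apply: (cvg_comp _ _ cq); apply: continuous_ln; rewrite divr_gt0.
  apply: cvgD.
    by apply: cvgD; [apply: cvgM => //; exact: cvg_cst|exact: cvg_cst].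
  apply: cvgD; last first.
    apply: cvgM; first exact: cvg_cst.
    apply: csum => i; apply: cvgD; last exact: cvg_cst.
    by apply: cvgM => //; exact: cvg_cst.
  apply: cvgD.
    apply: cvgM; first by apply: cvgB => //; exact: cvg_cst.
    by apply: cvgM => //; exact: cvg_cst.
  apply: cvgM => //; apply: cvgB; last exact: cvg_cst.
  apply: cvgD; first exact: cvg_cst.
  apply: cvgM; last exact: cvg_cst.
  apply: cvgB; first exact: cvg_cst.
  have ca : alpha * log_ratio1 (e1 z) @[z --> (p : W)] --> alpha * log_ratio1 (v1 ord0).
    by apply: cvgM => //; exact: cvg_cst.
  by apply: (cvg_comp _ _ ca); exact: continuous_expR.
- move=> [q [v0 v1]] [/= qa [/= Kv0 Kv1]] Hmax.
  exists q, (v0 ord0), (v1 ord0); split; [by rewrite in_itv/= in qa|exact: K1P|exact: K1P|].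
  move=> q' rho0' rho1' qa' h0' h1'.
  have := Hmax (q', (\row_i rho0' i, \row_i rho1' i)).
  have e (rho : 'I_N -> R) : (\row_i rho i) ord0 = rho by apply/funext => i; rewrite mxE.
  rewrite /= !e; apply; split; first by rewrite /= in_itv.
  by split; exact: K1r.
Qed.

End radii_program.

Section bound_attained.
Context {R : realType} (c : R3 R) (NT Nr : nat) (Thetas : 'I_NT -> set (R3 R)).
Context (r : nat -> R) (dmax : R) (m M : nat) (alpha lambda JT : R).
Context (Yf : 'I_NT -> int -> R) (YH : 'I_NT * 'I_Nr -> int -> R) (j : 'I_NT).
Context (A B : nat -> R) (C D : 'I_Nr -> nat -> R).

Local Notation area := (fine (solid_angle (Thetas j))).
Local Notation kappa := (lambda / JT).
Local Notation f := (F dmax m (Yf j) area).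
Local Notation g := (fun i : 'I_Nr => F dmax m (YH (j, i)) (fine (volume (cells c Thetas r (j, i))))).

Hypotheses (alpha0 : alpha < 0) (kappa0 : 0 <= kappa).
Hypotheses (r0 : forall i : 'I_Nr, 0 < r i) (rS : forall i : 'I_Nr, r i <= r i.+1).
Hypothesis fAB : affine_inf M area f A B.
Hypothesis gCD : forall i : 'I_Nr, affine_inf M (Upsilon area (r i) (r i.+1)) (g i) (C i) (D i).

Let area0 : 0 <= area. Proof. exact: fine_ge0. Qed.

(** If [q] or [area - q] is 0, the radius picked by [xget] is arbitrary, but its term has
    coefficient 0 on both sides, even against [-oo]. *)
Lemma gamma_Upsilon q (rho0 rho1 : 'I_Nr -> R) :
  gamma c Thetas r dmax m alpha lambda JT YH j q
    (fun i : 'I_Nr => Upsilon (area - q) (rho0 i) (r i.+1)) (fun i : 'I_Nr => Upsilon q (r i) (rho1 i)) =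
  gamma_radii area alpha kappa r g q rho0 rho1.
Proof.
rewrite /gamma /gamma_radii; congr (_ + _ + _)%E.
- have [->|h] := eqVneq (area - q) 0; first by rewrite !mul0r.
  congr ((_ * (_ * _))%:E); apply: eq_bigr => i _.
  by rewrite inner_radius_Upsilon.
- have [->|h] := eqVneq q 0; first by rewrite !mul0e.
  congr (_ * lne (1 - expR (_ * _))%:E)%E; apply: eq_bigr => i _.
  by rewrite outer_radius_Upsilon.
Qed.

Local Notation objective := (objective c Thetas r dmax m alpha lambda JT Yf YH j).
Local Notation local_bound := (local_bound c Thetas r dmax m alpha lambda JT Yf YH j).
Local Notation primal := (primal area alpha kappa r f g).

Lemma primal_le_objective q rho0 rho1 : 0 <= q <= area ->
  in_cells r rho0 -> in_cells r rho1 -> (primal q rho0 rho1 <= objective q)%E.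
Proof.
move=> /andP[q0 qa] h0 h1; rewrite /Defs.objective /primal; apply: leeD => //.
apply: ereal_sup_ubound.
exists (fun i : 'I_Nr => Upsilon (area - q) (rho0 i) (r i.+1)), (fun i : 'I_Nr => Upsilon q (r i) (rho1 i)).
split; last by rewrite gamma_Upsilon.
- move=> i; have /andP[h2 h3] := h1 i.
  by rewrite Upsilon_ge0 ?Upsilon_le.
- move=> i; have /andP[h2 h3] := h0 i; have qa' : 0 <= area - q by rewrite subr_ge0.
  by rewrite Upsilon_ge0 ?Upsilon_le// (lt_le_trans (r0 i)).
Qed.

(** Every feasible pair of volume vectors comes from radii in the cells, also over a null area,
    where 0 is the only feasible volume. *)
Lemma objective_le q (x : \bar R) : 0 <= q <= area ->
  (forall rho0 rho1, in_cells r rho0 -> in_cells r rho1 -> (primal q rho0 rho1 <= x)%E) ->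
  (objective q <= x)%E.
Proof.
move=> /andP[q0 qa] H; rewrite /Defs.objective -leeBrDl//.
apply: ge_ereal_sup => _ [V0 [V1 [hV1 hV0 ->]]].
have qa' : 0 <= area - q by rewrite subr_ge0.
have /(_ _)/cid2 P0 i := Upsilon_inner_onto qa' (r0 i) (rS i) (hV0 i).
have /(_ _)/cid2 P1 i := Upsilon_outer_onto q0 (r0 i) (rS i) (hV1 i).
rewrite (_ : V0 = fun i : 'I_Nr => Upsilon (area - q) (s2val (P0 i)) (r i.+1)); last first.
  by apply/funext => i; rewrite -(s2valP' (P0 i)).
rewrite (_ : V1 = fun i : 'I_Nr => Upsilon q (r i) (s2val (P1 i))); last first.
  by apply/funext => i; rewrite -(s2valP' (P1 i)).
rewrite gamma_Upsilon leeBrDl//; apply: H => i; [exact: s2valP (P0 i)|exact: s2valP (P1 i)].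
Qed.

Lemma primal_le_local_bound q rho0 rho1 : 0 <= q <= area ->
  in_cells r rho0 -> in_cells r rho1 -> (primal q rho0 rho1 <= local_bound)%E.
Proof.
move=> qa h0 h1; apply: le_trans (primal_le_objective qa h0 h1) _.
by apply: ereal_sup_ubound; exists q => //; rewrite /= in_itv.
Qed.

Lemma local_bound_attained : exists2 q, 0 <= q <= area & local_bound = objective q.
Proof.
have [q [rho0 [rho1 [qa h0 h1 Hmax]]]] :=
  primal_attained area0 alpha0 kappa0 r0 rS fAB gCD.
exists q => //; apply/eqP; rewrite eq_le; apply/andP; split; last first.
  by apply: ereal_sup_ubound; exists q => //; rewrite /= in_itv.
apply: ge_ereal_sup => _ [q' + <-]; rewrite /= in_itv/= => qa'.
apply: le_trans (primal_le_objective qa h0 h1).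
by apply: objective_le => // rho0' rho1' h0' h1'; exact: Hmax.
Qed.

End bound_attained.

(** * Bounds on the integrand *)

(** Each threshold that [z] has reached contributes one step [dmax / m]. In the descent from [m.*2],
    either [z] is already below [threshold v], or the step lost in the threshold is returned by the
    indicator. *)
Lemma level_le {R : realType} (dmax : R) (m u : nat) (z : \bar R) :
  0 < dmax -> (0 < m)%N -> (u <= m.*2)%N -> (z < (threshold dmax m m.*2)%:E)%E ->
  (z <= (threshold dmax m u +
     \sum_(u <= s < m.*2) dmax / m%:R * (~~ (z < (threshold dmax m s)%:E)%E)%:R)%:E)%E.
Proof.
move=> dmax0 m0 um zM; rewrite -(subKn um).
elim: (m.*2 - u)%N (leq_subr u m.*2) => [_|n IH nm].
  by rewrite subn0 big_geq// addr0 ltW.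
have := IH (ltnW nm).
set v := (m.*2 - n.+1)%N; have -> : (m.*2 - n)%N = v.+1 by rewrite /v subnSK.
have vm : (v < m.*2)%N by rewrite /v ltn_subrL/= (leq_trans _ nm).
have dm0 : 0 <= dmax / m%:R by rewrite divr_ge0 ?ler0n ?(ltW dmax0).
move=> H; rewrite big_ltn//; case: ltP => zv /=.
  rewrite mulr0 add0r; apply: le_trans (ltW zv) _; rewrite lee_fin lerDl sumr_ge0// => s _.
  by rewrite mulr_ge0.
apply: le_trans H _; rewrite lee_fin mulr1 addrA.
have -> // : threshold dmax m v.+1 = threshold dmax m v + dmax / m%:R.
by rewrite /threshold !intrB -!pmulrn -natr1; field; rewrite pnatr_eq0 -lt0n.
Qed.

(** * Level sets of the logit *)

Section summary_measure.
Context {R : realType} {d : measure_display} {T : measurableType d}.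
Context (mu : {measure set T -> \bar R}) (dmax : R) (m : nat) (W : set T) (p : T -> R) (Y : int -> R).
Hypotheses (mW : measurable W) (fW : mu W \is a fin_num) (mp : measurable_fun W p).
Hypothesis Jdef : J_defined m Y (fine (mu W)).
Hypothesis sumY : forall k : int, - m%:Z <= k <= m%:Z ->
  mu (W `&` [set x | (logit p x < (k%:~R * dmax / m%:R)%:E)%E]) = (Y k)%:E.
Hypotheses (dmax0 : 0 < dmax).

Definition below (s : nat) : set T := [set x | (logit p x < (threshold dmax m s)%:E)%E].

Let mlow (s : nat) : measurable (W `&` below s).
Proof. by apply: emeasurable_fun_infty_o => //; exact: measurable_logit. Qed.

(** The logit is known to be measurable on [W] only, so [below s] is first cut down to [W]. *)
Let not_belowE (s : nat) : W `\` below s = W `\` (W `&` below s).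
Proof.
apply/seteqP; split => x [Wx h]; split => //; first by case.
by move=> bx; apply: h.
Qed.

Lemma measurable_not_below (s : nat) : measurable (W `\` below s).
Proof. by rewrite not_belowE; exact: measurableD. Qed.

Let yE s : (s <= m.*2)%N -> mu (W `&` below s) = (nat_summary m Y s)%:E.
Proof.
by move=> sm; apply: sumY; lia.
Qed.

(** [J_defined] at [S = 0] gives a level set of full measure, hence the top one has full measure
    too: the logit is below [dmax] almost everywhere. *)
Lemma regular_summary_measure : regular_summary m Y (fine (mu W)).
Proof.
have mono u v : (u <= v <= m.*2)%N -> nat_summary m Y u <= nat_summary m Y v.
  move=> /andP[uv vm]; rewrite -lee_fin -!yE ?(leq_trans uv)//.
  apply: le_measure; rewrite ?inE// => x [Wx]; rewrite /below/= => h; split => //=.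
  apply: lt_le_trans h _; rewrite lee_fin /threshold.
  by rewrite ler_wpM2r ?invr_ge0 ?ler0n// ler_wpM2r ?(ltW dmax0)// ler_int; lia.
have le_w u : (u <= m.*2)%N -> nat_summary m Y u <= fine (mu W).
  move=> um; rewrite -lee_fin -yE// fineK//.
  by apply: le_measure; rewrite ?inE//; exact: subIsetl.
split=> //; apply/eqP; rewrite eq_le le_w//=.
have [|k km] := Jdef (S := 0); first by rewrite lexx fine_ge0.
rewrite subr0 => /le_trans; apply.
have kE : k = `|(k + m%:Z)%R|%N%:Z - m%:Z by lia.
by rewrite kE; apply: mono; lia.
Qed.

Lemma measure_not_below (s : nat) : (s <= m.*2)%N ->
  mu (W `\` below s) = (fine (mu W) - nat_summary m Y s)%:E.
Proof.
move=> sm; rewrite not_belowE measureD//; last by rewrite -ge0_fin_numE.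
by rewrite setIA setIid [X in (_ - X)%E](yE sm) EFinB fineK.
Qed.

End summary_measure.

Section integral_value.
Local Open Scope ereal_scope.
Context {R : realType} {d : measure_display} {T : measurableType d}.
Context (mu : {measure set T -> \bar R}) (D : set T).
Hypothesis mD : measurable D.
Hypothesis fD : mu D \is a fin_num.
Implicit Types (h : T -> R) (v k : R).

(** Integrability and value travel together, so the integral of a composite bound is assembled by
    closure lemmas alone. *)
Definition has_int h v := mu.-integrable D (EFin \o h) /\ \int[mu]_(x in D) (h x)%:E = v%:E.

Lemma has_intD h1 h2 v1 v2 : has_int h1 v1 -> has_int h2 v2 ->
  has_int (fun x => h1 x + h2 x)%R (v1 + v2)%R.
Proof.
move=> [i1 e1] [i2 e2]; split.
  by have := integrableD mD i1 i2; apply: eq_integrable.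
under eq_integral do rewrite EFinD.
by rewrite integralD// e1 e2.
Qed.

Lemma has_intZ k h v : has_int h v -> has_int (fun x => k * h x)%R (k * v)%R.
Proof.
move=> [i e]; split.
  by have := integrableZl mD k i; apply: eq_integrable.
under eq_integral do rewrite EFinM.
by rewrite integralZl// e.
Qed.

Lemma has_int_sum (I : Type) (s : seq I) (P : pred I) (h : I -> T -> R) (v : I -> R) :
  (forall i, has_int (h i) (v i)) ->
  has_int (fun x => \sum_(i <- s | P i) h i x)%R (\sum_(i <- s | P i) v i)%R.
Proof.
move=> H; elim: s => [|i s IH].
  rewrite (_ : (fun _ => _) = cst 0%R); last by apply/funext => x; rewrite big_nil.
  by rewrite big_nil; split; [exact: integrable0|rewrite integral0].
rewrite (_ : (fun _ => _) = (fun x => (if P i then h i x else 0) +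
    \sum_(i <- s | P i) h i x)%R); last first.
  by apply/funext => x; rewrite big_cons; case: ifP; rewrite ?add0r.
rewrite big_cons; case: ifP => Pi; first exact: has_intD.
by rewrite -[X in has_int _ X]add0r; apply: has_intD => //;
  split; [exact: integrable0|rewrite integral0].
Qed.

Lemma has_int_indic (E : set T) : measurable E -> has_int (\1_E) (fine (mu (E `&` D))).
Proof.
move=> mE; have fED : mu (E `&` D) \is a fin_num.
  rewrite ge0_fin_numE//; apply: (@le_lt_trans _ _ (mu D)); last by rewrite -ge0_fin_numE.
  by apply: le_measure; rewrite ?inE//; exact: measurableI.
have e : \int[mu]_(x in D) (\1_E x)%:E = mu (E `&` D) by rewrite integral_indic.
split; last by rewrite e fineK.
apply/integrableP; split; first exact/measurable_EFinP.
rewrite (eq_integral (fun x => (\1_E x)%:E)); last by move=> x _; rewrite gee0_abs// lee_fin.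
by rewrite e -ge0_fin_numE.
Qed.

Lemma has_int_cst k : has_int (cst k) (k * fine (mu D)).
Proof.
have := has_intZ k (has_int_indic (@measurableT _ T)); rewrite setTI.
suff -> : (fun x => k * \1_[set: T] x)%R = cst k by [].
by apply/funext => x; rewrite indicT mulr1.
Qed.

Lemma has_int_le (g : T -> \bar R) h v : has_int h v -> measurable_fun D g ->
  {ae mu, forall x, D x -> g x <= (h x)%:E} -> \int[mu]_(x in D) g x <= v%:E.
Proof. by move=> [ih <-] mg gh; exact: le_integral_integrable_ub. Qed.

End integral_value.

Section section_integral.
Local Open Scope ereal_scope.
Context {R : realType} {d : measure_display} {T : measurableType d}.

(** Tonelli covers nonnegative functions on the whole product; [h] is split into positive and
    negative parts, each extended by 0. *)
Lemma measurable_section_integral (D : set T) (I : set (measurableTypeR R))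
    (h : T * measurableTypeR R -> \bar R) :
  measurable D -> measurable I -> measurable_fun (D `*` I) h ->
  measurable_fun D (fun x => \int[lebesgue_measure]_(r in I) h (x, r)).
Proof.
move=> mD mI mh; have mDI := measurableX mD mI.
have nn (k : T * measurableTypeR R -> \bar R) : measurable_fun (D `*` I) k ->
    (forall z, 0 <= k z) ->
    measurable_fun D (fun x => \int[lebesgue_measure]_(r in I) k (x, r)).
  move=> mk k0.
  have mk' : measurable_fun setT (k \_ (D `*` I)) by apply/(measurable_restrictT _ mDI).
  have k0' z : 0 <= (k \_ (D `*` I)) z by rewrite patchE; case: ifP.
  have := measurable_fun_fubini_tonelli_F (m2 := @lebesgue_measure R) _ mk' k0'.
  move=> /(@measurable_funS _ _ _ _ setT D _ measurableT (@subsetT _ _)).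
  apply: eq_measurable_fun => x; rewrite inE => Dx.
  rewrite /fubini_F [RHS]integral_mkcond; apply: eq_integral => r _.
  rewrite !patchE; case: ifPn => xr; case: ifPn => rI //.
    by move: rI; rewrite notin_setE; case; move: xr; rewrite inE => -[].
  by move: xr; rewrite notin_setE; case; split => //; rewrite inE in rI.
have mp := nn _ (measurable_funepos mh) (funepos_ge0 h).
have mn := nn _ (measurable_funeneg mh) (funeneg_ge0 h).
rewrite (_ : (fun _ => _) = fun x => \int[lebesgue_measure]_(r in I) h^\+ (x, r) -
    \int[lebesgue_measure]_(r in I) h^\- (x, r)); first exact: emeasurable_funB.
apply/funext => x; rewrite integralE.
by congr (_ - _); apply: eq_integral => r _; rewrite ?funeposE ?funenegE.
Qed.

End section_integral.

(** * Mass and projection along a ray *)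

Section radial_mass.
Context {R : realType} (c : R3 R) (a b : R).
Hypotheses (a0 : 0 < a) (ab : a <= b).
Notation mu := (@lebesgue_measure R).
Implicit Types (x : R3 R) (E : set (R3 R)).

Definition mass E x : R :=
  fine (\int[mu]_(r in `[a, b[) (r ^+ 2 * \1_E (ray c x r))%:E)%E.

Lemma measurable_on_ray x E : measurable E ->
  measurable ((fun r : measurableTypeR R => ray c x r) @^-1` E).
Proof.
move=> mE; rewrite -[X in measurable X]setTI.
suff : measurable_fun setT (fun r : measurableTypeR R => ray c x r) by exact.
exact: (measurableT_comp (measurable_ray c) (pair1_measurable x)).
Qed.

Let msqr x E (D : set (measurableTypeR R)) : measurable E ->
  measurable_fun D (fun r : measurableTypeR R => (r ^+ 2 * \1_E (ray c x r))%:E).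
Proof.
move=> mE; apply/measurable_EFinP; apply: measurable_funM.
  by apply: measurable_funX; exact: measurable_id.
by apply: measurable_indic; exact: measurable_on_ray.
Qed.

Let int_le x E : measurable E ->
  (\int[mu]_(r in `[a, b[) (r ^+ 2 * \1_E (ray c x r))%:E <= ((b ^+ 3 - a ^+ 3) / 3)%:E)%E.
Proof.
move=> mE; rewrite -(@integral_sqr _ a b true true)//; apply: ge0_le_integral => //.
- by move=> r _; rewrite lee_fin mulr_ge0 ?sqr_ge0.
- exact: msqr.
- by apply/measurable_EFinP; apply: measurable_funX; exact: measurable_id.
- move=> r _; rewrite lee_fin indicE; case: (_ \in _); rewrite ?mulr1 ?mulr0//.
  exact: sqr_ge0.
Qed.

Let int_ge0 x E : (0 <= \int[mu]_(r in `[a, b[) (r ^+ 2 * \1_E (ray c x r))%:E)%E.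
Proof. by apply: integral_ge0 => r _; rewrite lee_fin mulr_ge0 ?sqr_ge0. Qed.

Lemma massE x E : measurable E ->
  (\int[mu]_(r in `[a, b[) (r ^+ 2 * \1_E (ray c x r))%:E = (mass E x)%:E)%E.
Proof.
move=> mE; rewrite /mass fineK// ge0_fin_numE//.
by apply: le_lt_trans (int_le _ mE) _; rewrite ltry.
Qed.

Lemma mass_ge0 x E : 0 <= mass E x. Proof. exact: fine_ge0. Qed.

Lemma mass_le x E : measurable E -> mass E x <= (b ^+ 3 - a ^+ 3) / 3.
Proof. by move=> mE; rewrite -lee_fin -massE// int_le. Qed.

Lemma measurable_mass E : measurable E -> measurable_fun setT (mass E).
Proof.
move=> mE; apply: measurableT_comp => //.
apply: (@measurable_section_integral _ _ _ setT `[a, b[%classic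
  (fun z => (z.2 ^+ 2 * \1_E (ray c z.1 z.2))%:E)) => //.
apply: measurable_funTS; apply/measurable_EFinP; apply: measurable_funM.
  by apply: measurable_funX; exact: measurable_snd.
exact: (measurableT_comp (measurable_indic mE) (measurable_ray c)).
Qed.

(** Integrable because bounded by the mass of a full ray; the value, given by polar coordinates,
    turns every radial mass in the bounds into a volume. *)
Lemma has_int_mass D E : measurable D -> D `<=` sphere -> measurable E ->
  has_int solid_angle D (mass E) (fine (volume (E `&` shell c D `[a, b[))).
Proof.
move=> mD DS mE.
have e : (\int[solid_angle]_(x in D) (mass E x)%:E = volume (E `&` shell c D `[a, b[))%E.
  by rewrite polar_coordinates//; apply: eq_integral => x _; rewrite massE.
have fD : solid_angle D \is a fin_num by exact: solid_angle_fin.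
have i : solid_angle.-integrable D (EFin \o mass E).
  apply: measurable_bounded_integrable => //.
  - by rewrite -ge0_fin_numE.
  - by apply: measurable_funTS; exact: measurable_mass.
  - exists ((b ^+ 3 - a ^+ 3) / 3); split; first exact: num_real.
    move=> M hM x _; rewrite /= ger0_norm ?mass_ge0//; apply: le_trans (ltW hM); exact: mass_le.
split => //; rewrite e fineK// -e; exact: integrable_fin_num.
Qed.

End radial_mass.

Section projection_bounds.
Context {R : realType} (c : R3 R) (Theta v : set (R3 R)) (N : nat) (r : nat -> R).
Hypotheses (r0 : forall i : 'I_N, 0 < r i) (rS : forall i : 'I_N, r i < r i.+1) (N0 : (0 < N)%N).
Hypotheses (ThetaS : Theta `<=` sphere) (mTheta : measurable Theta) (mv : measurable v).
Hypothesis vsub : v `<=` shell c Theta `[r 0%N, r N].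
Notation mu := (@lebesgue_measure R).
Implicit Types (x : R3 R).

Let rS' i : (i < N)%N -> r i < r i.+1.
Proof. by move=> iN; exact: (rS (Ordinal iN)). Qed.

Let r00 : 0 < r 0%N. Proof. exact: (r0 (Ordinal N0)). Qed.

Lemma on_ray_radius x s : sphere x -> 0 <= s -> v (ray c x s) -> r 0%N <= s <= r N.
Proof.
move=> x1 s0 /vsub; rewrite shell_coneE//; last exact: itv_gt0.
by case; rewrite /ray (addrC c) addrK norm3Z// x1 mulr1 /= in_itv.
Qed.

(** Inversion is discontinuous at 0, but on this half-line it coincides with the measurable [powR]
    of exponent -1. *)
Lemma measurable_inv_ge0 : measurable_fun (`[0%R, +oo[%classic : set (measurableTypeR R)) (fun s : measurableTypeR R => s^-1 : measurableTypeR R).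
Proof.
have H : measurable_fun (`[0%R, +oo[%classic : set (measurableTypeR R)) (fun s : measurableTypeR R => s `^ (-1) : measurableTypeR R).
  by apply: measurable_funTS; exact: measurable_powR.
by apply: eq_measurable_fun H => s; rewrite inE/= in_itv/= andbT => s0; rewrite powR_inv1.
Qed.

Let mproj x : measurable_fun (`[0%R, +oo[%classic : set (measurableTypeR R)) (fun s : measurableTypeR R => (\1_v (ray c x s) / s)%:E).
Proof.
apply/measurable_EFinP; apply: measurable_funM; last exact: measurable_inv_ge0.
by apply: measurable_funTS; apply: measurable_indic; exact: measurable_on_ray.
Qed.

(** The ray meets [v] only at radii between [r 0] and [r N]; dropping the negligible endpoint [r N]
    leaves half-open cells. *)
Lemma projection_cells x : sphere x ->
  projection c v x = (\sum_(i < N) \int[mu]_(s in `[r i, r i.+1[) (\1_v (ray c x s) / s)%:E)%E.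
Proof.
move=> x1.
have sub : `[r 0%N, r N[ `<=` `[0%R, +oo[.
  by move=> s; rewrite /= !in_itv/= andbT => /andP[/(le_trans (ltW r00))].
rewrite -(@integral_cells _ (fun s => (\1_v (ray c x s) / s)%:E))//; last first.
  by apply: measurable_funS (mproj x).
rewrite integral_itv_bndo_bndc; last exact: measurable_funS (mproj x).
rewrite /projection integral_mkcond [RHS]integral_mkcond; apply: eq_integral => s _.
rewrite !patchE; case: ifPn => s1; case: ifPn => s2 //; last first.
  move: s1; rewrite notin_setE; case; move: s2; rewrite inE/= !in_itv/= andbT => /andP[h _].
  exact: le_trans (ltW r00) h.
rewrite inE/= in_itv/= andbT in s1.
rewrite indicE memNset ?mul0r// => vs; move: s2; rewrite notin_setE; case.
by rewrite /= in_itv/=; exact: on_ray_radius vs.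
Qed.

Lemma measurable_projection : measurable_fun setT (projection c v).
Proof.
apply: (@measurable_section_integral _ _ _ setT `[0%R, +oo[%classic
  (fun z => (\1_v (ray c z.1 z.2) / z.2)%:E)) => //.
apply/measurable_EFinP; apply: measurable_funM.
  apply: measurable_funTS; exact: (measurableT_comp (measurable_indic mv) (measurable_ray c)).
apply: (measurable_comp (F := (`[0%R, +oo[%classic : set (measurableTypeR R)))); [by []| |exact: measurable_inv_ge0|].
  by move=> _ [z [_ h] <-].
by apply: measurable_funTS; exact: measurable_snd.
Qed.

Definition cell_mass (E : set (R3 R)) x (i : 'I_N) : R := mass c (r i) (r i.+1) E x.

(* Integrates to 0 over D when rho makes the layers between t0 and t1 above D as
   large as v. *)
Definition slack (rho : 'I_N -> R) (t0 t1 : 'I_N -> R) x : R :=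
  \sum_(i < N) rho i ^- 3 * (cell_mass v x i - (t1 i ^+ 3 - t0 i ^+ 3) / 3).

Lemma projection_le (rho : 'I_N -> R) x : sphere x -> in_cells r rho ->
  (projection c v x <= (log_ratio1 r rho + slack rho (fun i => r i) rho x)%:E)%E.
Proof.
move=> x1 h; rewrite projection_cells// /log_ratio1 /slack -big_split/= -sumEFin.
apply: lee_sum => i _; have /andP[h1 h2] := h i.
have := bathtub_le (measurable_on_ray c x mv) (r0 i) h1 h2.
rewrite massE ?(ltW (rS i))// -/(cell_mass v x i) -!EFinM.
rewrite -leeBrDr//; move/le_trans; apply.
by rewrite -!EFinD lee_fin; lra.
Qed.

Lemma projection_ge (rho : 'I_N -> R) x : sphere x -> in_cells r rho ->
  ((log_ratio0 r rho + slack rho rho (fun i => r i.+1) x)%:E <= projection c v x)%E.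
Proof.
move=> x1 h; rewrite projection_cells// /log_ratio0 /slack -big_split/= -sumEFin.
apply: lee_sum => i _; have /andP[h1 h2] := h i.
have := bathtub_ge (measurable_on_ray c x mv) (r0 i) h1 h2.
rewrite massE ?(ltW (rS i))// -/(cell_mass v x i) -!EFinM.
rewrite -leeBlDr//; apply: le_trans.
by rewrite -!EFinD lee_fin; lra.
Qed.

(** Any radii in the cells give two finite bounds; the inner boundaries are one choice. *)
Lemma projection_fin x : sphere x -> projection c v x \is a fin_num.
Proof.
move=> x1; have h : in_cells r (fun i : 'I_N => r i) by move=> i; rewrite lexx ltW.
rewrite fin_numE; apply/andP; split.
  by rewrite gt_eqF// (lt_le_trans _ (projection_ge x1 h))// ltNyr.
by rewrite lt_eqF// (le_lt_trans (projection_le x1 h))// ltry.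
Qed.

End projection_bounds.

(** Two tangents, to [ln] at [t] and to [exp] by [1 + alpha * e <= expR (alpha * e)], make the bound
    affine in the deviation [e]. A deviation of integral 0 then disappears, which takes the place of
    Jensen's inequality. *)
Lemma log_P_true_le {R : realType} (alpha L e t : R) (l : \bar R) :
  alpha < 0 -> 0 < t -> (l <= (L + e)%:E)%E -> l \is a fin_num ->
  (log_P alpha true l <=
   (ln t + (1 - expR (alpha * L) - alpha * expR (alpha * L) * e) / t - 1)%:E)%E.
Proof.
move=> al0 t0 lLe fl; rewrite -(fineK fl) /log_P -EFinM.
apply: le_trans (lne_tangent (1 - expR (alpha * fine l)) t0) _; rewrite lee_fin lerB// lerD2l.
rewrite ler_pM2r ?invr_gt0//.
have lLe' : fine l <= L + e by rewrite -lee_fin fineK.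
have h1 : expR (alpha * (L + e)) <= expR (alpha * fine l) by rewrite ler_expR ler_nM2l.
have h2 : expR (alpha * (L + e)) = expR (alpha * L) * expR (alpha * e) by rewrite mulrDr expRD.
have h3 := expR_ge1Dx (alpha * e).
have h4 : expR (alpha * L) * (1 + alpha * e) <= expR (alpha * L) * expR (alpha * e).
  by rewrite ler_wpM2l// expR_ge0.
by move: h1; rewrite h2 => h1; move: h4; rewrite mulrDr mulr1; lra.
Qed.

Lemma volume_shell {R : realType} (c : R3 R) (D : set (R3 R)) (a b : R) :
  0 < a -> a <= b -> measurable D -> D `<=` sphere ->
  volume (shell c D `[a, b[) = (Upsilon (fine (solid_angle D)) a b)%:E.
Proof.
move=> a0 ab mD DS; rewrite -[shell _ _ _]setTI polar_coordinates//.
rewrite (eq_integral (fun=> ((b ^+ 3 - a ^+ 3) / 3)%:E)); last first.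
  move=> x _; rewrite -(@integral_sqr _ a b true true)//.
  by apply: eq_integral => r _; rewrite indicT mulr1.
rewrite integral_cst// -[X in (_ * X)%E]fineK ?solid_angle_fin//.
by rewrite -EFinM /Upsilon; congr EFin; field.
Qed.

Lemma has_int_setU {d} {T : measurableType d} {R : realType}
    (mu : {measure set T -> \bar R}) (D1 D2 : set T) (h : T -> R) (v1 v2 v : R) :
  measurable D1 -> measurable D2 -> [disjoint D1 & D2] ->
  has_int mu D1 h v1 -> has_int mu D2 h v2 -> has_int mu (D1 `|` D2) h v -> v1 + v2 = v.
Proof.
move=> m1 m2 d12 [_ e1] [_ e2] [i e]; apply: EFin_inj.
by rewrite EFinD -e1 -e2 -e integral_setU//; exact: measurable_int i.
Qed.

(** * Bounding the integral over one solid angle *)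

Section cell_bounds.
Context {R : realType} (c : R3 R) (Theta Th v : set (R3 R)) (N : nat) (r : nat -> R).
Context (dmax : R) (m : nat) (pH : R3 R -> R) (YH : 'I_N -> int -> R).
Hypotheses (r0 : forall i : 'I_N, 0 < r i) (rS : forall i : 'I_N, r i < r i.+1) (N0 : (0 < N)%N).
Hypotheses (ThetaS : Theta `<=` sphere) (mTheta : measurable Theta).
Hypotheses (mTh : measurable Th) (ThTheta : Th `<=` Theta) (mv : measurable v).
Hypotheses (dmax0 : 0 < dmax) (m0 : (0 < m)%N).
Hypothesis mpH : measurable_fun (shell c Theta `[r 0%N, r N]) pH.
Notation cell i := (shell c Th `[r (nat_of_ord i), r (nat_of_ord i).+1[).
Hypothesis JH : forall i : 'I_N, J_defined m (YH i) (fine (volume (cell i))).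
Hypothesis sumH : forall (i : 'I_N) (k : int), - m%:Z <= k <= m%:Z ->
  volume (cell i `&` [set x | (logit pH x < (k%:~R * dmax / m%:R)%:E)%E]) = (YH i k)%:E.
Notation mu := (@lebesgue_measure R).

Let r_le (a b : nat) : (a <= b <= N)%N -> r a <= r b.
Proof.
have step n : (a + n <= N)%N -> r a <= r (a + n)%N.
  elim: n => [|n IH]; first by rewrite addn0.
  rewrite addnS => h; apply: le_trans (IH (ltnW h)) _.
  by rewrite ltW// (rS (Ordinal h)).
by move=> /andP[ab bN]; rewrite -(subnKC ab); apply: step; rewrite subnKC.
Qed.

Let r00 : 0 < r 0%N. Proof. exact: (r0 (Ordinal N0)). Qed.

Let ThS : Th `<=` sphere. Proof. by move=> x /ThTheta /ThetaS. Qed.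

Lemma measurable_cell (i : 'I_N) : measurable (cell i).
Proof. by apply: measurable_shell => //; exact: itv_gt0. Qed.

Lemma cell_sub_shell (i : 'I_N) : cell i `<=` shell c Theta `[r 0%N, r N].
Proof.
move=> _ [x Thx [s + <-]]; rewrite /= in_itv/= => /andP[s1 s2].
exists x; first exact: (ThTheta Thx).
exists s => //.
by rewrite /= in_itv/= (le_trans _ s1) ?(le_trans (ltW s2))//; apply: r_le;
  have := ltn_ord i; lia.
Qed.

Let mpHc (i : 'I_N) : measurable_fun (cell i) pH.
Proof.
apply: measurable_funS mpH; last exact: cell_sub_shell.
by apply: measurable_shell => //; exact: itv_gt0.
Qed.

Let fcell (i : 'I_N) : volume (cell i) \is a fin_num.
Proof. by rewrite volume_shell// ltW. Qed.

Definition high (i : 'I_N) (s : nat) : set (R3 R) := cell i `\` below dmax m pH s.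

Lemma measurable_high i s : measurable (high i s).
Proof. by apply: measurable_not_below => //; exact: measurable_cell. Qed.

Lemma regular_cell i : regular_summary m (YH i) (fine (volume (cell i))).
Proof.
exact: (regular_summary_measure (measurable_cell i) (@fcell i) (@mpHc i) (@JH i) (@sumH i) dmax0).
Qed.

Lemma volume_high i s : (s <= m.*2)%N ->
  volume (high i s) = (fine (volume (cell i)) - nat_summary m (YH i) s)%:E.
Proof.
move=> sm.
exact: (measure_not_below (measurable_cell i) (@fcell i) (@mpHc i) (@sumH i) dmax0 sm).
Qed.

Definition radial_term x : \bar R :=
  (\int[mu]_(s in `[r 0%N, r N]) ((s ^+ 2 * \1_v (ray c x s))%:E * logit pH (ray c x s)))%E.

Let mray (D : set (R3 R)) : measurable D -> D `<=` Theta ->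
  measurable_fun (D `*` (`[r 0%N, r N]%classic : set (measurableTypeR R)))
    (fun z => ((z.2 ^+ 2 * \1_v (ray c z.1 z.2))%:E * logit pH (ray c z.1 z.2))%E).
Proof.
move=> mD DT; apply: emeasurable_funM.
  apply: measurable_funTS; apply/measurable_EFinP; apply: measurable_funM.
    by apply: measurable_funX; exact: measurable_snd.
  exact: (measurableT_comp (measurable_indic mv) (measurable_ray c)).
apply: (measurable_comp (F := shell c Theta `[r 0%N, r N])).
- by apply: measurable_shell => //; exact: itv_gt0.
- by move=> _ [[x s] [/= Dx Is] <-]; exists x; [exact: DT|exists s].
- exact: measurable_logit.
- by apply: measurable_funTS; exact: measurable_ray.
Qed.

Lemma measurable_radial_term : measurable_fun Theta radial_term.
Proof.
apply: (@measurable_section_integral _ _ _ Theta `[r 0%N, r N]%classic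
  (fun z => ((z.2 ^+ 2 * \1_v (ray c z.1 z.2))%:E * logit pH (ray c z.1 z.2))%E)) => //.
exact: mray.
Qed.

Let has_int_ray (i : 'I_N) x E : measurable E ->
  has_int mu `[r i, r i.+1[ (fun s => s ^+ 2 * \1_E (ray c x s)) (cell_mass c r E x i).
Proof.
move=> mE; have e := massE c (ltW (rS i)) x mE.
split => //; apply/integrableP; split.
  apply/measurable_EFinP; apply: measurable_funM.
    by apply: measurable_funX; exact: measurable_id.
  by apply: measurable_funTS; apply: measurable_indic; exact: measurable_on_ray.
rewrite (eq_integral (fun s : measurableTypeR R => (s ^+ 2 * \1_E (ray c x s))%:E)); last first.
  by move=> s _; rewrite /= ger0_norm// mulr_ge0 ?sqr_ge0.
by rewrite e ltry.
Qed.

(** The first sum counts the high points of the whole ray, not just those in [v]. So [v] enters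
    through its mass alone, and over [Th] this sum integrates to [excess]. *)
Definition cell_ub (vv : 'I_N -> nat) (i : 'I_N) x : R :=
  \sum_(vv i <= s < m.*2) dmax / m%:R * cell_mass c r (high i s) x i
  + threshold dmax m (vv i) * cell_mass c r v x i.

(** The last premise puts the logit below the top threshold at almost every radius, so that
    [level_le] applies inside [v]; outside [v] the integrand is 0 and the bound is nonnegative. *)
Lemma radial_term_le (vv : 'I_N -> nat) x : (forall i, (vv i <= m.*2)%N) -> Th x ->
  (forall i, cell_mass c r (high i m.*2) x i = 0) ->
  (radial_term x <= (\sum_(i < N) cell_ub vv i x)%:E)%E.
Proof.
move=> vm Thx null; rewrite /radial_term.
have mI : measurable_fun (`[r 0%N, r N]%classic : set (measurableTypeR R))
    (fun s => (s ^+ 2 * \1_v (ray c x s))%:E * logit pH (ray c x s))%E.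
  apply: emeasurable_funM.
    apply/measurable_EFinP; apply: measurable_funM.
      by apply: measurable_funX; exact: measurable_id.
    by apply: measurable_funTS; apply: measurable_indic; exact: measurable_on_ray.
  apply: (measurable_comp (F := shell c Theta `[r 0%N, r N])).
  - by apply: measurable_shell => //; exact: itv_gt0.
  - by move=> _ [s /= Is <-]; exists x; [exact: ThTheta|exists s].
  - exact: measurable_logit.
  - apply: measurable_funTS.
    exact: (measurableT_comp (measurable_ray c) (pair1_measurable x)).
have mI' : measurable_fun (`[r 0%N, r N[%classic : set (measurableTypeR R))
    (fun s => (s ^+ 2 * \1_v (ray c x s))%:E * logit pH (ray c x s))%E.
  apply: measurable_funS mI => // s; rewrite /= !in_itv/= => /andP[-> /ltW ->//].
rewrite -integral_itv_bndo_bndc// (@integral_cells _ _ r N) //; last first.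
  by move=> i iN; exact: (rS (Ordinal iN)).
rewrite -sumEFin; apply: lee_sum => i _.
have sub : `[r i, r i.+1[%classic `<=` `[r 0%N, r N[%classic.
  move=> s; rewrite /= !in_itv/= => /andP[s1 s2].
  by rewrite (le_trans _ s1) ?(lt_le_trans s2)//; apply: r_le; have := ltn_ord i; lia.
have mJ : measurable (`[r i, r i.+1[%classic : set (measurableTypeR R)).
  exact: measurable_itv.
have hi := fun s => has_int_ray i x (measurable_high i s).
(* The weight [s ^+ 2] is positive on the cell, so zero mass means that almost every radius avoids
   the set. *)
have null_ray : {ae mu, forall s, `[r i, r i.+1[%classic s -> ~ high i m.*2 (ray c x s)}.
  have [ii ei] := hi m.*2; rewrite null in ei.
  have mf := measurable_int _ ii.
  have /ae_eq_integral_abs : (\int[mu]_(s in `[r i, r i.+1[)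
      `|(s ^+ 2 * \1_(high i m.*2) (ray c x s))%:E| = 0)%E.
    rewrite -[RHS]ei; apply: eq_integral => s _.
    by rewrite gee0_abs// lee_fin mulr_ge0 ?sqr_ge0.
  move=> /(_ (measurable_itv _) mf); apply: filterS => s + sI => /(_ sI) /eqP.
  rewrite /= eqe indicE => /eqP s0 hs; move: s0; rewrite mem_set// mulr1 => /eqP.
  rewrite sqrf_eq0 gt_eqF//; apply: lt_le_trans (r0 i) _.
  by move: sI; rewrite /= in_itv/= => /andP[].
rewrite /cell_ub.
apply: (@has_int_le _ _ _ mu _ _ _ (fun s : measurableTypeR R =>
   \sum_(vv i <= k < m.*2) dmax / m%:R * (s ^+ 2 * \1_(high i k) (ray c x s))
    + threshold dmax m (vv i) * (s ^+ 2 * \1_v (ray c x s)))) => //.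
- apply: (has_intD mJ); last by apply: (has_intZ mJ); exact: has_int_ray.
  by apply: (has_int_sum mJ) => k; apply: (has_intZ mJ); exact: hi.
- exact: measurable_funS mI'.
move: null_ray; apply: filterS; first exact: (ae_filter_ringOfSetsType mu).
move=> s + sI => /(_ sI) nhs.
have sr : cell i (ray c x s) by exists x => //; exists s.
have s2 : 0 <= s ^+ 2 by rewrite sqr_ge0.
have sumge0 : 0 <= \sum_(vv i <= k < m.*2) dmax / m%:R * (s ^+ 2 * \1_(high i k) (ray c x s)).
  apply: sumr_ge0 => k _; rewrite mulr_ge0 ?divr_ge0 ?ler0n ?(ltW dmax0)//.
  by rewrite mulr_ge0.
rewrite [\1_v _]indicE; case: (boolP (_ \in v)) => vs; last first.
  by rewrite !mulr0 mul0e addr0 lee_fin.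
have lt : (logit pH (ray c x s) < (threshold dmax m m.*2)%:E)%E.
  by apply: contrapT => nlt; apply: nhs.
have := level_le dmax0 m0 (vm i) lt.
rewrite !mulr1 => /(lee_wpmul2l (x := (s ^+ 2)%:E)); rewrite lee_fin s2 => /(_ isT) /le_trans; apply.
rewrite -EFinM lee_fin mulrDr addrC mulr_sumr [_ * threshold _ _ _]mulrC lerD2r.
apply: ler_sum => k _; rewrite mulrCA ler_wpM2l ?divr_ge0 ?ler0n ?(ltW dmax0)//.
rewrite ler_wpM2l// indicE ler_nat; case: (boolP (_ < _)%E) => //= nb.
by rewrite mem_set//; split => //; exact/negP.
Qed.

(** The part of a cell above the top threshold has volume 0, so by polar coordinates its mass
    vanishes on almost every ray. *)
Lemma radial_term_ae_le (vv : 'I_N -> nat) : (forall i, (vv i <= m.*2)%N) ->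
  {ae solid_angle, forall x, Th x -> (radial_term x <= (\sum_(i < N) cell_ub vv i x)%:E)%E}.
Proof.
move=> vm.
have nulli i : {ae solid_angle, forall x, Th x -> cell_mass c r (high i m.*2) x i = 0}.
  have mh := measurable_high i m.*2.
  have [ii ei] := has_int_mass c (r0 i) (ltW (rS i)) mTh ThS mh.
  have mf := measurable_int _ ii.
  have z : volume (high i m.*2 `&` cell i) = 0%E.
    rewrite (_ : _ `&` _ = high i m.*2); last by apply/setIidPl => y [].
    by rewrite volume_high// (proj2 (regular_cell i)) subrr.
  have /ae_eq_integral_abs : (\int[solid_angle]_(x in Th)
      `|(mass c (r i) (r i.+1) (high i m.*2) x)%:E| = 0)%E.
    rewrite -[RHS]/(fine 0%E)%:E -z -ei; apply: eq_integral => x _.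
    by rewrite gee0_abs// lee_fin mass_ge0.
  move=> /(_ mTh mf); apply: filterS => x + Thx => /(_ Thx) /eqP.
  by rewrite eqe => /eqP.
have : {ae solid_angle, forall x, forall i, Th x -> cell_mass c r (high i m.*2) x i = 0}.
  exact: filter_forall.
by apply: filterS => x h Thx; apply: radial_term_le => // i; exact: h.
Qed.


Lemma has_int_cell_ub D (vv : 'I_N -> nat) i : measurable D -> D `<=` Th ->
  has_int solid_angle D (cell_ub vv i)
    (\sum_(vv i <= s < m.*2) dmax / m%:R * fine (volume (high i s `&` shell c D `[r i, r i.+1[))
     + threshold dmax m (vv i) * fine (volume (v `&` shell c D `[r i, r i.+1[))).
Proof.
move=> mD DTh; have DS : D `<=` sphere by move=> x /DTh /ThS.
apply: (has_intD mD).
  apply: (has_int_sum mD) => s; apply: (has_intZ mD); apply: has_int_mass => //; first exact: ltW.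
  exact: measurable_high.
by apply: (has_intZ mD); apply: has_int_mass => //; exact: ltW.
Qed.

Lemma has_int_slack D rho t0 t1 : measurable D -> D `<=` sphere ->
  has_int solid_angle D (slack c v r rho t0 t1)
    (\sum_(i < N) rho i ^- 3 * (fine (volume (v `&` shell c D `[r i, r i.+1[))
       - (t1 i ^+ 3 - t0 i ^+ 3) / 3 * fine (solid_angle D))).
Proof.
move=> mD DS; apply: (has_int_sum mD) => i; apply: (has_intZ mD); apply: (has_intD mD).
  by apply: has_int_mass => //; exact: ltW.
by have := has_int_cst mD (solid_angle_fin mD) (- ((t1 i ^+ 3 - t0 i ^+ 3) / 3)); rewrite mulNr.
Qed.

Context (q : set (R3 R)) (pf : R3 R -> R) (Yf : int -> R) (alpha kappa : R).
Hypotheses (mq : measurable q) (alpha0 : alpha < 0) (kappa0 : 0 <= kappa).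
Hypothesis mpf : measurable_fun Theta pf.
Hypothesis vsub : v `<=` shell c Theta `[r 0%N, r N].
Hypothesis Jf : J_defined m Yf (fine (solid_angle Th)).
Hypothesis sumf : forall (k : int), - m%:Z <= k <= m%:Z ->
  solid_angle (Th `&` [set x | (logit pf x < (k%:~R * dmax / m%:R)%:E)%E]) = (Yf k)%:E.

Definition integrand x : \bar R :=
  ((\1_q x)%:E * logit pf x + log_P alpha (x \in q) (projection c v x)
   + kappa%:E * radial_term x)%E.

(** [log_P] is defined by cases on membership in [q], so the two sides of [q] are treated
    separately; there the finite projection is replaced by its real value. *)
Lemma measurable_integrand : measurable_fun Theta integrand.
Proof.
have mQ : measurable (Theta `&` q) by exact: measurableI.
have mQc : measurable (Theta `\` q) by exact: measurableD.
have ml D : D `<=` Theta -> measurable D -> measurable_fun D (fun x => fine (projection c v x)).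
  move=> DT mD; apply: measurableT_comp => //; apply: measurable_funTS.
  exact: measurable_projection.
have mr D : D `<=` Theta -> measurable D -> measurable_fun D (fun x => kappa%:E * radial_term x)%E.
  move=> DT mD; apply: emeasurable_funM => //.
  exact: measurable_funS measurable_radial_term.
have pfin x : Theta x -> projection c v x = (fine (projection c v x))%:E.
  by move=> Tx; rewrite fineK//; apply: projection_fin vsub _ _ => //; exact: ThetaS.
rewrite -(setUIDK Theta q); apply/measurable_funU => //; split.
  have H : measurable_fun (Theta `&` q) (fun x => logit pf x
      + lne (1 - expR (alpha * fine (projection c v x)))%:E + kappa%:E * radial_term x)%E.
    apply: emeasurable_funD; last by apply: mr => //; exact: subIsetl.
    apply: emeasurable_funD.
      by apply: measurable_logit; apply: measurable_funS mpf => //; exact: subIsetl.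
    apply: (measurableT_comp (@measurable_lne_EFin R)); apply: measurable_funB => //.
    apply: (measurableT_comp (@measurable_expR R)); apply: measurable_funM => //.
    by apply: ml => //; exact: subIsetl.
  apply: eq_measurable_fun H => x; rewrite inE => -[Tx qx].
  by rewrite /integrand indicE mem_set// mul1e /log_P (pfin x).
have H : measurable_fun (Theta `\` q) (fun x =>
    (alpha * fine (projection c v x))%:E + kappa%:E * radial_term x)%E.
  apply: emeasurable_funD; last by apply: mr => //; exact: subDsetl.
  apply/measurable_EFinP; apply: measurable_funM => //.
  by apply: ml => //; exact: subDsetl.
apply: eq_measurable_fun H => x; rewrite inE => -[Tx qx].
by rewrite /integrand indicE memNset// mul0e add0e /log_P [in RHS](pfin x).
Qed.

Let mpfTh : measurable_fun Th pf. Proof. exact: measurable_funS mpf. Qed.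
Let fTh : solid_angle Th \is a fin_num. Proof. exact: solid_angle_fin. Qed.
Notation area := (fine (solid_angle Th)).

Definition high_image (s : nat) : set (R3 R) := Th `\` below dmax m pf s.

Let mhigh_image s : measurable (high_image s).
Proof. exact: measurable_not_below. Qed.

Lemma regular_image : regular_summary m Yf area.
Proof. exact: (regular_summary_measure mTh fTh mpfTh Jf sumf dmax0). Qed.

Lemma solid_angle_high_image s : (s <= m.*2)%N ->
  solid_angle (high_image s) = (area - nat_summary m Yf s)%:E.
Proof. by move=> sm; exact: (measure_not_below mTh fTh mpfTh sumf dmax0 sm). Qed.

Lemma image_ae_below : {ae solid_angle, forall x, Th x ->
  (logit pf x < (threshold dmax m m.*2)%:E)%E}.
Proof.
exists (high_image m.*2); split => //.
  by rewrite solid_angle_high_image// (proj2 regular_image) subrr.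
by move=> x /= /not_implyP[Thx h]; split.
Qed.

(** Also added outside [q], where its nonnegativity suffices: only over the whole of [Th] does it
    integrate to [excess]. *)
Definition image_ub (u : nat) x : R :=
  \sum_(u <= s < m.*2) dmax / m%:R * \1_(high_image s) x.

Lemma image_ub_ge0 u x : 0 <= image_ub u x.
Proof. by apply: sumr_ge0 => s _; rewrite mulr_ge0 ?divr_ge0 ?ler0n ?(ltW dmax0). Qed.

Lemma logit_le_image_ub u x : (u <= m.*2)%N -> Th x ->
  (logit pf x < (threshold dmax m m.*2)%:E)%E ->
  (logit pf x <= (threshold dmax m u + image_ub u x)%:E)%E.
Proof.
move=> um Thx lt; apply: le_trans (level_le dmax0 m0 um lt) _.
rewrite lee_fin lerD2l ler_sum// => s _.
rewrite ler_wpM2l ?divr_ge0 ?ler0n ?(ltW dmax0)// indicE ler_nat.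
case: (boolP (_ < _)%E) => //= nb; rewrite mem_set//; split => //; exact/negP.
Qed.

Variables (u : nat) (vv : 'I_N -> nat) (t : R) (rho0 rho1 : 'I_N -> R).
Hypotheses (um : (u <= m.*2)%N) (vm : forall i, (vv i <= m.*2)%N) (t0 : 0 < t).
Hypotheses (h0 : in_cells r rho0) (h1 : in_cells r rho1).

Let Q := Th `&` q.
Let Qc := Th `\` q.
Let mQ : measurable Q. Proof. exact: measurableI. Qed.
Let mQc : measurable Qc. Proof. exact: measurableD. Qed.
Let L0 := log_ratio0 r rho0.
Let L1 := log_ratio1 r rho1.
Let e1 := expR (alpha * L1).

(** The coefficient of [slack] is the derivative of [(1 - expR (alpha * l)) / t] in [l] at [L1]. *)
Let ub_in x : R :=
  (threshold dmax m u + (ln t + (1 - e1) / t - 1)) + image_ub u x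
  + - alpha * e1 / t * slack c v r rho1 (fun i => r i) rho1 x
  + kappa * \sum_(i < N) cell_ub vv i x.

Let ub_out x : R :=
  alpha * L0 + image_ub u x + alpha * slack c v r rho0 rho0 (fun i => r i.+1) x
  + kappa * \sum_(i < N) cell_ub vv i x.

Let kappa_radial_le x : (radial_term x <= (\sum_(i < N) cell_ub vv i x)%:E)%E ->
  (kappa%:E * radial_term x <= (kappa * \sum_(i < N) cell_ub vv i x)%:E)%E.
Proof. by move=> h; rewrite EFinM lee_wpmul2l// lee_fin. Qed.

Let integrand_in : {ae solid_angle, forall x, Q x -> (integrand x <= (ub_in x)%:E)%E}.
Proof.
apply: filterS2 image_ae_below (radial_term_ae_le vm) => x hf hr [Thx qx].
have x1 := ThS Thx.
rewrite /integrand /ub_in indicE mem_set// mul1e.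
rewrite EFinD; apply: leeD; last by apply: kappa_radial_le; exact: hr.
have pl := projection_le r0 rS N0 ThetaS mv vsub x1 h1.
have pfin := projection_fin r0 rS N0 ThetaS mv vsub x1.
apply: le_trans (leeD (logit_le_image_ub um Thx (hf Thx)) (log_P_true_le alpha0 t0 pl pfin)) _.
rewrite -EFinD lee_fin -/L1 -/e1.
set S := slack _ _ _ _ _ _ _.
have -> : (1 - e1 - alpha * e1 * S) / t = (1 - e1) / t + - alpha * e1 / t * S.
  by field; rewrite gt_eqF.
by lra.
Qed.

Let integrand_out : {ae solid_angle, forall x, Qc x -> (integrand x <= (ub_out x)%:E)%E}.
Proof.
apply: filterS (radial_term_ae_le vm) => x hr [Thx qx].
have x1 := ThS Thx.
rewrite /integrand /ub_out indicE memNset// mul0e add0e.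
rewrite EFinD; apply: leeD; last by apply: kappa_radial_le; exact: hr.
have pg := projection_ge r0 rS N0 ThetaS mv vsub x1 h0.
have pfin := projection_fin r0 rS N0 ThetaS mv vsub x1.
rewrite /log_P -(fineK pfin) -EFinM lee_fin.
have : alpha * fine (projection c v x) <= alpha * (L0 + slack c v r rho0 rho0 (fun i => r i.+1) x).
  by rewrite ler_nM2l// -lee_fin fineK.
have := image_ub_ge0 u x; rewrite mulrDr; lra.
Qed.

Hypothesis V1E : forall i : 'I_N, fine (volume (v `&` shell c Q `[r i, r i.+1[)) =
  Upsilon (fine (solid_angle Q)) (r i) (rho1 i).
Hypothesis V0E : forall i : 'I_N, fine (volume (v `&` shell c Qc `[r i, r i.+1[)) =
  Upsilon (area - fine (solid_angle Q)) (rho0 i) (r i.+1).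

Lemma integral_le_dual :
  (\int[solid_angle]_(x in Th) integrand x <=
   (dual area alpha kappa r (threshold dmax m) (excess dmax m Yf area)
     (fun=> threshold dmax m)
     (fun i => excess dmax m (YH i) (fine (volume (cell i))))
     u vv t (fine (solid_angle Q)) rho0 rho1)%:E)%E.
Proof.
have QS : Q `<=` sphere by move=> x [/ThS].
have QcS : Qc `<=` sphere by move=> x [/ThS].
have QT : Q `<=` Th by exact: subIsetl.
have QcT : Qc `<=` Th by exact: subDsetl.
have dQ : [disjoint Q & Qc].
  by rewrite disj_set2E; apply/eqP/seteqP; split => // x [[_ qx] [_]].
have ThE : Q `|` Qc = Th by exact: setUIDK.
have fQ (D : set (R3 R)) : measurable D -> solid_angle D \is a fin_num by exact: solid_angle_fin.
have areaE : area - fine (solid_angle Q) = fine (solid_angle Qc).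
  have := has_int_setU mQ mQc dQ (has_int_cst mQ (fQ _ mQ) 1) (has_int_cst mQc (fQ _ mQc) 1).
  rewrite ThE => /(_ _ (has_int_cst mTh fTh 1)).
  by rewrite !mul1r => <-; ring.
have mint : measurable_fun Th integrand.
  by apply: measurable_funS measurable_integrand.
have mintU : measurable_fun (Q `|` Qc) integrand by rewrite ThE.
rewrite -[X in (\int[_]_(x in X) _)%E]ThE integral_setU//.
have hub (D : set (R3 R)) : measurable D -> has_int solid_angle D (image_ub u)
    (\sum_(u <= s < m.*2) dmax / m%:R * fine (solid_angle (high_image s `&` D))).
  by move=> mD; apply: (has_int_sum mD) => s; apply: (has_intZ mD); apply: has_int_indic => //; exact: fQ.
have hcu D : measurable D -> D `<=` Th -> has_int solid_angle D (fun x => \sum_(i < N) cell_ub vv i x) _ :=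
  fun mD DT => has_int_sum mD _ _ (fun i => has_int_cell_ub vv i mD DT).
have hin := has_intD mQ (has_intD mQ (has_intD mQ
    (has_int_cst mQ (fQ _ mQ) (threshold dmax m u + (ln t + (1 - e1) / t - 1))) (hub _ mQ))
  (has_intZ mQ (- alpha * e1 / t) (has_int_slack rho1 (fun i => r i) rho1 mQ QS)))
  (has_intZ mQ kappa (hcu Q mQ QT)).
have hout := has_intD mQc (has_intD mQc (has_intD mQc
    (has_int_cst mQc (fQ _ mQc) (alpha * L0)) (hub _ mQc))
  (has_intZ mQc alpha (has_int_slack rho0 rho0 (fun i => r i.+1) mQc QcS)))
  (has_intZ mQc kappa (hcu Qc mQc QcT)).
have leQ := has_int_le mQ hin (measurable_funS mTh QT mint) integrand_in.
have leQc := has_int_le mQc hout (measurable_funS mTh QcT mint) integrand_out.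
apply: le_trans (leeD leQ leQc) _.
rewrite -EFinD lee_fin.
(* By [V1E] and [V0E] the radii reproduce the volumes of [v] on each side of the segmentation, so
   both slacks integrate to 0. *)
have s1 : \sum_(i < N) rho1 i ^- 3 * (fine (volume (v `&` shell c Q `[r i, r i.+1[))
    - (rho1 i ^+ 3 - r i ^+ 3) / 3 * fine (solid_angle Q)) = 0.
  by apply: big1 => i _; rewrite V1E /Upsilon; ring.
have s0 : \sum_(i < N) rho0 i ^- 3 * (fine (volume (v `&` shell c Qc `[r i, r i.+1[))
    - (r i.+1 ^+ 3 - rho0 i ^+ 3) / 3 * fine (solid_angle Qc)) = 0.
  by apply: big1 => i _; rewrite V0E areaE /Upsilon; ring.
rewrite s1 s0.
(* The high sets do not depend on [q]: their parts over [Q] and [Qc] add up to the whole, here for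
   the image and in [csum] for the cells. *)
have fsum : \sum_(u <= s < m.*2) dmax / m%:R * fine (solid_angle (high_image s `&` Q))
   + \sum_(u <= s < m.*2) dmax / m%:R * fine (solid_angle (high_image s `&` Qc)) =
   excess dmax m Yf area u.
  rewrite /excess mulr_sumr -big_split/=; apply: eq_big_nat => s /andP[_ sm].
  rewrite -mulrDr; congr (_ * _).
  have mh := mhigh_image s.
  have := has_int_setU mQ mQc dQ (has_int_indic mQ (fQ _ mQ) mh) (has_int_indic mQc (fQ _ mQc) mh).
  rewrite ThE => /(_ _ (has_int_indic mTh fTh mh)) ->.
  rewrite (_ : high_image s `&` Th = high_image s); last by apply/setIidPl => x [].
  by rewrite [X in fine X = _](solid_angle_high_image (ltnW sm)).
have csum i : \sum_(vv i <= s < m.*2) dmax / m%:R * fine (volume (high i s `&` shell c Q `[r i, r i.+1[))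
   + \sum_(vv i <= s < m.*2) dmax / m%:R * fine (volume (high i s `&` shell c Qc `[r i, r i.+1[)) =
   excess dmax m (YH i) (fine (volume (cell i))) (vv i).
  rewrite /excess mulr_sumr -big_split/=; apply: eq_big_nat => s /andP[_ sm].
  rewrite -mulrDr; congr (_ * _).
  have mh := measurable_high i s; have ri := ltW (rS i).
  have := has_int_setU mQ mQc dQ (has_int_mass c (r0 i) ri mQ QS mh)
    (has_int_mass c (r0 i) ri mQc QcS mh).
  rewrite ThE => /(_ _ (has_int_mass c (r0 i) ri mTh ThS mh)) ->.
  rewrite (_ : high i s `&` cell i = high i s); last by apply/setIidPl => x [].
  by rewrite [X in fine X = _](volume_high i (ltnW sm)).
rewrite /dual -fsum.
have -> : \sum_(i < N) (threshold dmax m (vv i) * filled area r (fine (solid_angle Q)) rho0 rho1 i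
     + excess dmax m (YH i) (fine (volume (cell i))) (vv i)) =
  \sum_(i < N) (\sum_(vv i <= s < m.*2) dmax / m%:R * fine (volume (high i s `&` shell c Q `[r i, r i.+1[))
     + threshold dmax m (vv i) * fine (volume (v `&` shell c Q `[r i, r i.+1[)))
  + \sum_(i < N) (\sum_(vv i <= s < m.*2) dmax / m%:R * fine (volume (high i s `&` shell c Qc `[r i, r i.+1[))
     + threshold dmax m (vv i) * fine (volume (v `&` shell c Qc `[r i, r i.+1[))).
  by rewrite -big_split/=; apply: eq_bigr => i _; rewrite -csum /filled -V1E -V0E; ring.
rewrite areaE -/L0 -/L1 -/e1.
set F1 := \sum_(u <= s < _) _; set F2 := \sum_(u <= s < _) _.
set C1 := \sum_(i < N) _; set C2 := \sum_(i < N) _.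
(* Both sides are equal: every loss has occurred in the pointwise bounds. *)
rewrite le_eqVlt; apply/orP; left; apply/eqP; ring.
Qed.

End cell_bounds.

Lemma fine_volume_shell_itv {R : realType} (c : R3 R) (D E : set (R3 R)) (a b : R) :
  0 < a -> a <= b -> measurable D -> D `<=` sphere -> measurable E ->
  0 <= fine (volume (E `&` shell c D `[a, b[)) <= Upsilon (fine (solid_angle D)) a b.
Proof.
move=> a0 ab mD DS mE; have mS : measurable (shell c D `[a, b[).
  by apply: measurable_shell => //; exact: itv_gt0.
have vS := volume_shell c a0 ab mD DS.
rewrite fine_ge0//= -lee_fin -vS.
have le : (volume (E `&` shell c D `[a, b[) <= volume (shell c D `[a, b[))%E.
  by apply: le_measure; rewrite ?inE//; exact: measurableI.
by rewrite fineK// ge0_fin_numE// (le_lt_trans le)// vS ltry.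
Qed.

Lemma integral_bigsetU {d} {T : measurableType d} {R : realType}
    (mu : {measure set T -> \bar R}) (I : choiceType) (s : seq I) (D : I -> set T) (f : T -> \bar R) :
  (forall i, measurable (D i)) -> uniq s -> trivIset [set` s] D ->
  measurable_fun (\big[setU/set0]_(i <- s) D i) f ->
  (\int[mu]_(x in \big[setU/set0]_(i <- s) D i) f x = \sum_(i <- s) \int[mu]_(x in D i) f x)%E.
Proof.
move=> mD; elim: s => [|i s IH]; first by rewrite !big_nil integral_set0.
rewrite !big_cons /= => /andP[si us] tD mf.
have mU : measurable (\big[setU/set0]_(k <- s) D k) by exact: bigsetU_measurable.
rewrite integral_setU// ?IH//.
- by apply: sub_trivIset tD => k /= ks; rewrite inE ks orbT.
- by apply: measurable_funS mf; [exact: measurableU|exact: subsetUr].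
- rewrite disj_set2E; apply/eqP/seteqP; split => // x [Dix].
  rewrite -bigcup_seq => -[k /= ks Dkx].
  have ik : i = k.
    by apply: tD => /=; [exact: mem_head|rewrite inE ks orbT|exists x].
  by rewrite ik ks in si.
Qed.

(** * From one solid angle to the partition *)

Section assembly.
Context {R : realType} (c : R3 R) (Theta : set (R3 R)) (NT Nr : nat).
Context (Thetas : 'I_NT -> set (R3 R)) (r : nat -> R) (dmax : R) (m : nat) (alpha lambda JT : R).
Context (Yf : 'I_NT -> int -> R) (YH : 'I_NT * 'I_Nr -> int -> R) (pf pH : R3 R -> R).
Hypotheses (r0 : forall i : 'I_Nr, 0 < r i) (rS : forall i : 'I_Nr, r i < r i.+1) (N0 : (0 < Nr)%N).
Hypotheses (ThetaS : Theta `<=` sphere) (mTheta : measurable Theta).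
Hypotheses (mThetas : forall j, measurable (Thetas j)) (sub : forall j, Thetas j `<=` Theta).
Hypotheses (dmax0 : 0 < dmax) (m0 : (0 < m)%N) (alpha0 : alpha < 0) (kappa0 : 0 <= lambda / JT).
Hypotheses (mpf : measurable_fun Theta pf) (mpH : measurable_fun (shell c Theta `[r 0%N, r Nr]) pH).
Hypothesis hYf : forall j, J_defined m (Yf j) (fine (solid_angle (Thetas j))).
Hypothesis hYH : forall ji, J_defined m (YH ji) (fine (volume (cells c Thetas r ji))).
Hypothesis hBfY : is_summary solid_angle dmax m Thetas pf Yf.
Hypothesis hBHY : is_summary volume dmax m (cells c Thetas r) pH YH.
Variable j : 'I_NT.

Let area := fine (solid_angle (Thetas j)).
Let ThS : Thetas j `<=` sphere. Proof. by move=> x /sub /ThetaS. Qed.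
Let JHj (i : 'I_Nr) : J_defined m (YH (j, i)) (fine (volume (shell c (Thetas j) `[r i, r i.+1[))).
Proof. exact: (@hYH (j, i)). Qed.
Let sumHj (i : 'I_Nr) (k : int) : - m%:Z <= k <= m%:Z ->
  volume (shell c (Thetas j) `[r i, r i.+1[ `&`
    [set x | (logit pH x < (k%:~R * dmax / m%:R)%:E)%E]) = (YH (j, i) k)%:E.
Proof. exact: (hBHY (j, i)). Qed.

Let image_affine : affine_inf m.*2 area (F dmax m (Yf j) area)
  (threshold dmax m) (excess dmax m (Yf j) area).
Proof.
apply: F_affine => //.
exact: (regular_summary_measure (mThetas j) (solid_angle_fin (mThetas j))
  (measurable_funS mTheta (@sub j) mpf) (@hYf j) (@hBfY j) dmax0).
Qed.

Let cell_affine (i : 'I_Nr) : affine_inf m.*2 (Upsilon area (r i) (r i.+1))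
  (F dmax m (YH (j, i)) (fine (volume (cells c Thetas r (j, i)))))
  (threshold dmax m) (excess dmax m (YH (j, i)) (fine (volume (cells c Thetas r (j, i))))).
Proof.
have wE : fine (volume (cells c Thetas r (j, i))) = Upsilon area (r i) (r i.+1).
  by rewrite /cells volume_shell// ltW.
rewrite -[X in affine_inf _ X]wE; apply: F_affine => //.
exact: (regular_cell r0 rS N0 ThetaS mTheta (mThetas j) (@sub j) dmax0 m0 mpH JHj sumHj i).
Qed.

Lemma local_max_attained : exists2 q, 0 <= q <= area &
  local_bound c Thetas r dmax m alpha lambda JT Yf YH j =
  objective c Thetas r dmax m alpha lambda JT Yf YH j q.
Proof.
apply: local_bound_attained image_affine cell_affine => // i; exact: ltW.
Qed.

(** The shapes are converted to a feasible point of the program: the area of [q] in [Thetas j], and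
    the radii of full layers with the volumes of [v] above [Q] and [Qc]. Then [le_primal] leaves one
    inequality per choice of multipliers. *)
Lemma integral_le_local_bound (q v : set (R3 R)) : measurable q -> measurable v ->
  v `<=` shell c Theta `[r 0%N, r Nr] ->
  (\int[solid_angle]_(x in Thetas j) integrand c v Nr r pH q pf alpha (lambda / JT) x <=
   local_bound c Thetas r dmax m alpha lambda JT Yf YH j)%E.
Proof.
move=> mq mv vsub.
set Q := Thetas j `&` q; set Qc := Thetas j `\` q.
have mQ : measurable Q by exact: measurableI.
have mQc : measurable Qc by exact: measurableD.
have QS : Q `<=` sphere by move=> x [/ThS].
have QcS : Qc `<=` sphere by move=> x [/ThS].
have areaE : area - fine (solid_angle Q) = fine (solid_angle Qc).
  have fD (D : set (R3 R)) : measurable D -> solid_angle D \is a fin_num by exact: (@solid_angle_fin R).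
  have dQ : [disjoint Q & Qc].
    by rewrite disj_set2E; apply/eqP/seteqP; split => // x [[_ qx] [_]].
  have ThE : Q `|` Qc = Thetas j by exact: setUIDK.
  have := has_int_setU mQ mQc dQ (has_int_cst mQ (fD _ mQ) 1) (has_int_cst mQc (fD _ mQc) 1).
  rewrite ThE => /(_ _ (has_int_cst (mThetas j) (fD _ (mThetas j)) 1)).
  by rewrite !mul1r /area => <-; ring.
have q0 : 0 <= fine (solid_angle Q) by exact: fine_ge0.
have qa : 0 <= area - fine (solid_angle Q) by rewrite areaE fine_ge0.
have /(_ _)/cid2 P1 (i : 'I_Nr) := Upsilon_outer_onto q0 (r0 i) (ltW (rS i))
  (fine_volume_shell_itv c (r0 i) (ltW (rS i)) mQ QS mv).
have V0itv (i : 'I_Nr) : 0 <= fine (volume (v `&` shell c Qc `[r i, r i.+1[)) <=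
    Upsilon (area - fine (solid_angle Q)) (r i) (r i.+1).
  by rewrite areaE; apply: fine_volume_shell_itv => //; exact: ltW.
have /(_ _)/cid2 P0 (i : 'I_Nr) := Upsilon_inner_onto qa (r0 i) (ltW (rS i)) (V0itv i).
pose rho0 i := s2val (P0 i); pose rho1 i := s2val (P1 i).
have h0 : in_cells r rho0 by move=> i; exact: (s2valP (P0 i)).
have h1 : in_cells r rho1 by move=> i; exact: (s2valP (P1 i)).
have qitv : 0 <= fine (solid_angle Q) <= area by rewrite q0 -subr_ge0 qa.
apply: le_trans (primal_le_local_bound c dmax m alpha lambda JT Yf YH r0 qitv h0 h1).
apply: (le_primal alpha0 r0 image_affine cell_affine qitv h0 h1) => u vv t um vm t0.
apply: (integral_le_dual r0 rS N0 ThetaS mTheta (mThetas j) (@sub j) mv dmax0 m0 mpH JHj sumHj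
  mq alpha0 kappa0 mpf vsub (@hYf j) (@hBfY j) um vm t0 h0 h1).
- by move=> i; exact: (s2valP' (P1 i)).
- by move=> i; exact: (s2valP' (P0 i)).
Qed.

End assembly.


Theorem theorem2 (R : realType)
  (* image domain, camera center, distances, standard partition *)
  (c : R3 R) (Theta : set (R3 R)) (Rmin Rmax beta : R) (NT Nr : nat)
  (Thetas : 'I_NT -> set (R3 R)) (r : nat -> R)
  (hTheta : Theta `<=` sphere)
  (hPi : standard_partition Theta Rmin Rmax beta Nr Thetas r)
  (* constants *)
  (dmax : R) (m : nat) (alpha lambda : R)
  (hdmax : 0 < dmax) (hm : (0 < m)%N) (halpha : alpha < 0) (hlambda : 0 < lambda)
  (* hypothesis: object class and pose *)
  (K : Type) (H : hypothesis R K) (JT : R)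
  (hJT : has_abs_jacobian (pose_of H) JT)
  (* summaries *)
  (Yf : 'I_NT -> int -> R) (YH : 'I_NT * 'I_Nr -> int -> R)
  (hYf : forall j, J_defined m (Yf j) (fine (solid_angle (Thetas j))))
  (hYH : forall ji, J_defined m (YH ji) (fine (volume (cells c Thetas r ji))))
  (* Bernoulli fields with these summaries *)
  (df dH : measure_display) (Sf : measurableType df) (SH : measurableType dH)
  (Pf : probability Sf R) (PH : probability SH R)
  (Bf : R3 R -> Sf -> bool) (BH : R3 R -> SH -> bool)
  (hBf : bernoulli_field Pf Theta Bf)
  (hBH : bernoulli_field PH (shell c Theta `[Rmin, Rmax]) BH)
  (hBfY : is_summary solid_angle dmax m Thetas (success_rate Pf Bf) Yf)
  (hBHY : is_summary volume dmax m (cells c Thetas r) (success_rate PH BH) YH) :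
  (forall j, exists2 q : R, 0 <= q <= fine (solid_angle (Thetas j)) &
     local_bound c Thetas r dmax m alpha lambda JT Yf YH j =
     objective c Thetas r dmax m alpha lambda JT Yf YH j q) /\
  (evidence c Theta Rmin Rmax alpha lambda JT
     (success_rate Pf Bf) (success_rate PH BH)
   <= evidence_bound c Theta Rmin Rmax Thetas r dmax m alpha lambda JT Yf YH
        (success_rate PH BH))%E.
Proof.
have [mThetas tThetas cover beta1 N0 rmin rmax rincr rgeom] := hPi.
have r00 : 0 < r 0%N by have := rincr _ N0; have := rgeom _ N0; nra.
have r0 (i : 'I_Nr) : 0 < r i.
  case: i => i /=; elim: i => // i IH h.
  by apply: lt_trans (rincr _ (ltnW h)); exact: IH (ltnW h).
have rS (i : 'I_Nr) : r i < r i.+1 by exact: rincr.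
have coverE : Theta = \big[setU/set0]_(j < NT) Thetas j.
  by rewrite -cover -bigcup_seq; apply: eq_bigcupl; split => k //= _; rewrite mem_index_enum.
have mTheta : measurable Theta by rewrite coverE; exact: bigsetU_measurable.
have sub j : Thetas j `<=` Theta by move=> x Tx; rewrite -cover; exists j.
have kappa0 : 0 <= lambda / JT by rewrite divr_ge0 ?ltW//; case: hJT.
have [_ _ mpf] := hBf; have [_ _ mpH] := hBH.
rewrite -rmin -rmax in mpH *.
split=> [j|].
  exact: (local_max_attained r0 rS N0 hTheta mTheta mThetas sub hdmax hm halpha kappa0
    mpf mpH hYf hYH hBfY hBHY j).
apply: ge_ereal_sup => _ [q [v [[_ [U oU qE] _] [vsub [V oV vE] _] ->]]].
have mq : measurable q.
  rewrite qE; apply: measurableI; last exact: open_measurable_R3.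
  have -> : sphere = @norm3 R @^-1` [set 1] by [].
  by rewrite -[X in measurable X]setTI; exact: measurable_norm3.
have mv : measurable v by rewrite vE; apply: measurableI => //; exact: open_measurable_R3.
(* The constant terms are the same extended real, possibly [-oo], so only the integral and the sum
   are compared. *)
rewrite /evidence_at /evidence_bound addeC; apply: leeD => //.
have mint := measurable_integrand r0 rS N0 hTheta mTheta mv mpH alpha (lambda / JT) mq mpf vsub.
rewrite -/(radial_term _ _ _ _ _ _) [X in (\int[_]_(x in X) _)%E]coverE integral_bigsetU//.
- apply: lee_sum => j _.
  exact: (integral_le_local_bound r0 rS N0 hTheta mTheta mThetas sub hdmax hm halpha kappa0
    mpf mpH hYf hYH hBfY hBHY j mq mv vsub).
- exact: index_enum_uniq.
- exact: sub_trivIset tThetas.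
- by rewrite -coverE.
Qed.
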